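(* Let $(\gamma_n)_{n\ge 0}$ be the finite positive measures on a measurable space $E$ defined by $\gamma_{n+1}=\gamma_nQ+\mu$, where $Q(x,dy)=G(x)M(x,dy)$, starting from a finite measure $\gamma_0$ with $\gamma_0(1)>0$, and let $\eta_n=\gamma_n/\gamma_n(1)$. Write $g_-=\inf_E G$ and $g_+=\sup_E G$, with $0<g_-\le g_+<\infty$. 1. Suppose $G(x)=1$ for all $x\in E$. Then $\gamma_n(1)=\gamma_0(1)+\mu(1)\,n$ for all $n\ge 0$. If moreover there is a probability measure $\eta_\infty=\eta_\infty M$ such that $\sum_{n\ge0}\sup_{x\in E}\|M^n(x,\cdot)-\eta_\infty\|_{\mathrm{tv}}<\infty$, then $\|\eta_n-\eta_\infty\|_{\mathrm{tv}}=O(1/n)$ as $n\to\infty$. 2. Suppose $g_+<1$ and $\mu(1)>0$. Then there is a constant $c<\infty$ such that for all $n\ge0$ and all $f\in\mathcal B(E)$, $$|\gamma_n(f)-\gamma_\infty(f)|\vee|\eta_n(f)-\eta_\infty(f)|\le c\,g_+^n\,\|f\|,$$ where $\gamma_\infty(f):=\sum_{n\ge0}\mu Q^n(f)$ and $\eta_\infty(f):=\gamma_\infty(f)/\gamma_\infty(1)$. 3. Suppose $g_->1$ and there exist $k\ge1$ and $\epsilon>0$ such that $M^k(x,\cdot)\ge\epsilon\,M^k(y,\cdot)$ (as measures) for all $x,y\in E$. Then the mapping $\Phi:\mathcal P(E)\to\mathcal P(E)$, $\Phi(\eta)(f)=\eta Q(f)/\eta Q(1)$, has a unique fixed point $\eta_\infty=\Phi(\eta_\infty)$,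 and $$\lim_{n\to\infty}\frac1n\log\gamma_n(1)=\log\eta_\infty(G),\qquad \|\eta_n-\eta_\infty\|_{\mathrm{tv}}\le c\,e^{-\lambda n}\ \text{ for all } n\ge0,$$ for some finite constant $c<\infty$ and some $\lambda>0$.
   Context: $(E,\mathcal E)$ is a measurable space, $G:E\to(0,\infty)$ is a measurable function, $M$ is a Markov kernel on $E$, and $\mu$ is a finite positive measure on $E$. $\mathcal B(E)$ is the space of bounded measurable real functions with uniform norm $\|f\|$, $\mathcal P(E)$ the set of probability measures on $E$. For a measure $\nu$ and a kernel $K$: $\nu(f)=\int f\,d\nu$, $K(f)(x)=\int K(x,dy)f(y)$, $(\nu K)(f)=\nu(K(f))$, $K^n$ is the $n$-fold composition, $K^0=Id$. For a difference $\nu$ of two probability measures, $\|\nu\|_{\mathrm{tv}}=\sup\{|\nu(f)|: f \text{ measurable},\ \mathrm{osc}(f)\le1\}$, where $\mathrm{osc}(f)=\sup_{x,y}|f(x)-f(y)|$. (The measures $\gamma_n$ are the intensity measures of a spatial branching point process with spontaneous births of intensity $\mu$.) *)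

(* Defs.v *)
From HB Require Import structures.
From mathcomp Require Import all_boot all_order all_algebra.
From mathcomp Require Import all_classical all_reals all_analysis.
From mathcomp Require Import measurable_realfun.

Set Implicit Arguments.
Unset Strict Implicit.
Unset Printing Implicit Defensive.
Import Order.TTheory GRing.Theory Num.Theory.
Import numFieldNormedType.Exports.

Local Open Scope classical_set_scope.
Local Open Scope ring_scope.

(* Measures are total functions on [set T], unconstrained outside the
   sigma-algebra, so equality of measures is not Leibniz equality. *)
Definition measure_eq d (T : measurableType d) (R : realType)
    (m1 m2 : {measure set T -> \bar R}) : Prop :=
  forall A, measurable A -> m1 A = m2 A.

Section measure_kernel.
Local Open Scope ereal_scope.
Context d (E : measurableType d) (R : realType).

(* nu K. The library's [kcomp_noparam] carries a measure structure only for
   subprobability kernels. *)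
Definition mact (nu : {measure set E -> \bar R}) (K : R.-ker E ~> E)
  (A : set E) : \bar R := \int[nu]_x K x A.

Section mact_measure.
Variables (nu : {measure set E -> \bar R}) (K : R.-ker E ~> E).

Let mact0 : mact nu K set0 = 0.
Proof. by apply: integral0_eq => x _; rewrite measure0. Qed.

Let mact_ge0 A : 0 <= mact nu K A.
Proof. by apply: integral_ge0 => x _; exact: measure_ge0. Qed.

Let mact_sigma_additive : semi_sigma_additive (mact nu K).
Proof.
move=> F mF tF mUF; rewrite /mact.
rewrite [X in _ --> X](_ : _ =
    \int[nu]_x \sum_(0 <= n <oo) K x (F n)); last first.
  apply: eq_integral => x _.
  by apply/esym/cvg_lim => //; exact: measure_semi_sigma_additive.
rewrite integral_nneseries//; last by move=> n; exact: measurable_kernel.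
apply: is_cvg_nneseries => n _ _.
by apply: integral_ge0 => x _; exact: measure_ge0.
Qed.

HB.instance Definition _ := isMeasure.Build _ _ _ (mact nu K)
  mact0 mact_ge0 mact_sigma_additive.

End mact_measure.

Section kmul.
Variables K L : R.-ker E ~> E.

Definition kmul (x : E) : {measure set E -> \bar R} := mact (K x) L.

Let measurable_kmul U : measurable U -> measurable_fun [set: E] (kmul ^~ U).
Proof.
move=> mU; apply: measurable_fun_integral_kernel => //.
- by move=> V mV; exact: measurable_kernel.
- exact: measurable_kernel.
Qed.

HB.instance Definition _ := isKernel.Build _ _ _ _ R kmul measurable_kmul.

End kmul.

Fixpoint kpow (K : R.-ker E ~> E) (n : nat) : R.-ker E ~> E :=
  if n is m.+1 then kmul (kpow K m) K
  else kdirac (@measurable_id _ E [set: E]).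

Section potential_kernel.
Variables (G : E -> R) (mG : measurable_fun [set: E] G).
Variables (G0 : forall x, (0 < G x)%R) (M : R.-ker E ~> E).

(* Q(x, dy) = G(x) M(x, dy) *)
Definition kpotential of measurable_fun [set: E] G := fun x =>
  (mscale (NngNum (ltW (G0 x))) (M x) : {measure set E -> \bar R}).

Let measurable_kpotential U :
  measurable U -> measurable_fun [set: E] ((kpotential mG) ^~ U).
Proof.
move=> mU; rewrite /kpotential /= /mscale /=.
apply: emeasurable_funM; last exact: measurable_kernel.
exact/measurable_EFinP.
Qed.

HB.instance Definition _ :=
  isKernel.Build _ _ _ _ R (kpotential mG) measurable_kpotential.

End potential_kernel.

Fixpoint gamma_seq (Q : R.-ker E ~> E) (mu gamma0 : {measure set E -> \bar R})
    (n : nat) : {measure set E -> \bar R} :=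
  if n is m.+1 then measure_add (mact (gamma_seq Q mu gamma0 m) Q) mu else gamma0.

(* The second argument of [mnormalize] is the value taken when the total mass
   is 0 or +oo. It plays no role when the mass lies in ]0, +oo[. *)
Definition eta_seq (Q : R.-ker E ~> E) (mu gamma0 : {measure set E -> \bar R})
  (n : nat) : probability E R := mnormalize (gamma_seq Q mu gamma0 n) point.

Definition Phi (Q : R.-ker E ~> E) (P : probability E R) : probability E R :=
  mnormalize (mact P Q) P.

End measure_kernel.

Section norms.
Context d (E : measurableType d) (R : realType).

Definition osc (f : E -> R) : \bar R :=
  ereal_sup [set (`|f x - f y|)%:E | x in [set: E] & y in [set: E]].

Definition tvdist (m1 m2 : {measure set E -> \bar R}) : \bar R :=
  ereal_sup [set (`|\int[m1]_x f x - \int[m2]_x f x|)%:E | f in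
    [set f : E -> R | measurable_fun [set: E] f /\ (osc f <= 1)%E]].

Definition bounded_measurable (f : E -> R) : Prop :=
  measurable_fun [set: E] f /\ bounded_fun f.

Definition unorm (f : E -> R) : R := sup (range (fun x => `|f x|)).

(* the terms mu Q^n (f) *)
Definition gamma_term (Q : R.-ker E ~> E) (mu : {measure set E -> \bar R})
  (f : E -> R) (n : nat) : R := \int[mact mu (kpow Q n)]_x f x.

Definition gamma_oo (Q : R.-ker E ~> E) (mu : {measure set E -> \bar R})
  (f : E -> R) : R := limn (series (gamma_term Q mu f)).

Definition eta_oo (Q : R.-ker E ~> E) (mu : {measure set E -> \bar R})
  (f : E -> R) : R := gamma_oo Q mu f / gamma_oo Q mu (cst 1).

End norms.

(* Main.v *)
(* Integration turns every measure into a positive linear functional on bounded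
   measurable functions and every kernel K into a positive operator f |-> K f,
   so that gamma_n (f) = gamma_0 (Q^n f) + \sum_(i < n) mu (Q^i f).

   If G = 1, then gamma_n (f) - gamma_n (1) eta (f) is bounded by
   gamma_0 (1) |M^n f - eta (f)| + mu (1) \sum_i |M^i f - eta (f)|. The sum is
   bounded by some B, and |M^n f - eta (f)| <= B / n.+1 because the summable
   bounds can be applied to M^i (M^(n - i) f) for all i <= n.

   If g_+ < 1, everything is controlled by |Q^n f| <= g_+^n ||f||.

   If g_- > 1, the minorization passes to Q^k and makes the width of the interval
   [inf Q^n f / Q^n 1, sup Q^n f / Q^n 1] contract by a constant factor every k
   steps. The common limit L (f) of these ratios is a positive functional which
   is dominated by a multiple of Q^k (x0, .), hence a probability measure, and
   L (Q f) = L (f) L (G) makes it the unique fixed point of Phi. With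
   theta = L (G), Q^n 1 is comparable to theta^n, which gives the growth rate;
   choosing a contraction rate rho with 1 / theta < rho < 1, the spontaneous
   births contribute to eta_n - L an error of order
   \sum_(i < n) rho^i theta^(i - n), which is O (rho^n). *)
Require Import Defs.
From HB Require Import structures.
From mathcomp Require Import all_boot all_order all_algebra.
From mathcomp Require Import ring lra.
From mathcomp Require Import all_classical all_reals all_analysis.
From mathcomp Require Import measurable_realfun.

Set Implicit Arguments.
Unset Strict Implicit.
Unset Printing Implicit Defensive.
Import Order.TTheory GRing.Theory Num.Theory.
Import numFieldNormedType.Exports.

Local Open Scope classical_set_scope.
Local Open Scope ring_scope.

(** * Positive linear functionals on bounded measurable functions *)

Section positive_functionals.
Context d (E : measurableType d) (R : realType).
Implicit Types (f g : E -> R) (F : (E -> R) -> R).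

(** [bounded_fun] is phrased through a filter. The filter is proper because [E] contains [point],
    and this yields an explicit bound. *)
Lemma bounded_measurableP f : bounded_measurable f <->
  measurable_fun [set: E] f /\ exists B, forall x, `|f x| <= B.
Proof.
have pE : ProperFilter (globally [set: E]).
  exact: (@globally_properfilter _ _ point).
split=> -[mf].
  by move=> /(@ex_bound _ _ _ _ _ pE)[B fB]; split=> //; exists B => x; exact: fB.
move=> [B fB]; split=> //; apply/(@ex_bound _ _ _ _ _ pE).
by exists B => x _; exact: fB.
Qed.

Lemma bounded_measurableMD a f g : bounded_measurable f ->
  bounded_measurable g -> bounded_measurable (fun x => a * f x + g x).
Proof.
move=> /bounded_measurableP[mf [B fB]] /bounded_measurableP[mg [C gC]].
apply/bounded_measurableP; split.
  by apply: measurable_funD => //; exact: measurable_funM.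
exists (`|a| * B + C) => x; rewrite (le_trans (ler_normD _ _))// lerD//.
by rewrite normrM ler_wpM2l.
Qed.

Lemma bounded_measurable_cst (a : R) : bounded_measurable (fun _ : E => a).
Proof.
apply/bounded_measurableP; split; first exact: measurable_cst.
by exists `|a|.
Qed.

Lemma bounded_measurableZ a f : bounded_measurable f ->
  bounded_measurable (fun x => a * f x).
Proof.
move=> bf; have := bounded_measurableMD a bf (bounded_measurable_cst 0).
by congr bounded_measurable; apply/funext => x; rewrite addr0.
Qed.

Lemma bounded_measurableD f g : bounded_measurable f ->
  bounded_measurable g -> bounded_measurable (fun x => f x + g x).
Proof.
move=> bf bg; have := bounded_measurableMD 1 bf bg.
by congr bounded_measurable; apply/funext => x; rewrite mul1r.
Qed.

Lemma bounded_measurableB f g : bounded_measurable f ->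
  bounded_measurable g -> bounded_measurable (fun x => f x - g x).
Proof.
move=> bf bg; have := bounded_measurableMD (-1) bg bf.
by congr bounded_measurable; apply/funext => x; rewrite mulN1r addrC.
Qed.

Lemma bounded_measurable_indic A : measurable A ->
  bounded_measurable (\1_A : E -> R).
Proof.
move=> mA; apply/bounded_measurableP; split; first exact: measurable_indic.
by exists 1 => x; rewrite indicE; case: (_ \in _); rewrite ?normr1 ?normr0.
Qed.

Lemma bounded_measurable_sum n (u : nat -> E -> R) :
  (forall i, bounded_measurable (u i)) ->
  bounded_measurable (fun x => \sum_(i < n) u i x).
Proof.
move=> bu; elim: n => [|n IH].
  rewrite (_ : (fun _ => _) = fun=> 0); last by apply/funext=> x; rewrite big_ord0.
  exact: bounded_measurable_cst.
rewrite (_ : (fun _ => _) = fun x => 1 * u n x + \sum_(i < n) u i x).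
  exact: bounded_measurableMD.
by apply/funext => x; rewrite big_ord_recr/= mul1r addrC.
Qed.

(** Linearity is asked only on bounded measurable functions, since integrals of arbitrary total
    functions [E -> R] are not additive. Addition and scaling are merged into one clause. *)
Definition poslin F :=
  (forall a f g, bounded_measurable f -> bounded_measurable g ->
    F (fun x => a * f x + g x) = a * F f + F g) /\
  (forall f, bounded_measurable f -> (forall x, 0 <= f x) -> 0 <= F f).

Section theory.
Variables (F : (E -> R) -> R) (pF : poslin F).

Lemma poslin0 : F (fun=> 0) = 0.
Proof.
have := pF.1 1 _ _ (bounded_measurable_cst 0) (bounded_measurable_cst 0).
rewrite (_ : (fun _ => _) = fun=> 0) => [H|]; first by lra.
by apply/funext => x; rewrite mulr0 addr0.
Qed.

Lemma poslinZ a f : bounded_measurable f -> F (fun x => a * f x) = a * F f.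
Proof.
move=> bf; have := pF.1 a _ _ bf (bounded_measurable_cst 0).
rewrite poslin0 addr0 => <-; congr F.
by apply/funext => x; rewrite addr0.
Qed.

Lemma poslinD f g : bounded_measurable f -> bounded_measurable g ->
  F (fun x => f x + g x) = F f + F g.
Proof.
move=> bf bg; have := pF.1 1 _ _ bf bg; rewrite mul1r => <-; congr F.
by apply/funext => x; rewrite mul1r.
Qed.

Lemma poslinB f g : bounded_measurable f -> bounded_measurable g ->
  F (fun x => f x - g x) = F f - F g.
Proof.
move=> bf bg; have := pF.1 (-1) _ _ bg bf.
rewrite mulN1r addrC => <-; congr F.
by apply/funext => x; rewrite mulN1r addrC.
Qed.

Lemma poslin_cst a : F (fun=> a) = a * F (fun=> 1).
Proof.
rewrite -poslinZ; last exact: bounded_measurable_cst.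
by congr F; apply/funext => x; rewrite mulr1.
Qed.

Lemma poslin_sum n (u : nat -> E -> R) :
  (forall i, bounded_measurable (u i)) ->
  F (fun x => \sum_(i < n) u i x) = \sum_(i < n) F (u i).
Proof.
move=> bu; elim: n => [|n IH].
  rewrite big_ord0 -[RHS]poslin0; congr F.
  by apply/funext => x; rewrite big_ord0.
rewrite big_ord_recr/= -IH -poslinD//; last exact: bounded_measurable_sum.
by congr F; apply/funext => x; rewrite big_ord_recr.
Qed.

Lemma poslin_le f g : bounded_measurable f -> bounded_measurable g ->
  (forall x, f x <= g x) -> F f <= F g.
Proof.
move=> bf bg fg; rewrite -subr_ge0 -poslinB//; apply: pF.2.
  exact: bounded_measurableB.
by move=> x; rewrite subr_ge0.
Qed.

Lemma poslin_norm_le f g : bounded_measurable f -> bounded_measurable g ->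
  (forall x, `|f x| <= g x) -> `|F f| <= F g.
Proof.
move=> bf bg fg; rewrite ler_norml; apply/andP; split.
  rewrite -mulN1r -poslinZ//; apply: poslin_le => //.
    exact: bounded_measurableZ.
  by move=> x; rewrite mulN1r; have := fg x; rewrite ler_norml => /andP[].
by apply: poslin_le => // x; rewrite (le_trans (ler_norm _)).
Qed.

End theory.

Lemma poslin_comb a F1 F2 : 0 <= a -> poslin F1 -> poslin F2 ->
  poslin (fun f => a * F1 f + F2 f).
Proof.
move=> a0 p1 p2; split=> [b f g bf bg|f bf f0].
  by rewrite p1.1// p2.1//; ring.
by rewrite addr_ge0 ?mulr_ge0 ?p1.2 ?p2.2.
Qed.

(* The sum counts the integers in [1, t], i.e. it is the floor of t. *)
Lemma sum_steps_approx n (t : R) : 0 <= t <= n%:R ->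
  `|t - \sum_(i < n) (i.+1%:R <= t)%R%:R| <= 1.
Proof.
elim: n => [|n IH] /andP[t0 tn].
  by rewrite big_ord0 (_ : t = 0) ?subr0 ?normr0//; apply/le_anti/andP.
rewrite big_ord_recr/=; have [ltn|ntn] := leP t n%:R.
  rewrite [_ <= t]leNgt (le_lt_trans ltn) ?ltr_nat//= addr0.
  by apply: IH; rewrite t0.
rewrite (eq_bigr (fun=> 1)); last first.
  by move=> i _; rewrite (le_trans _ (ltW ntn))// ler_nat.
rewrite sumr_const card_ord.
have := @natr1 R n.
by case: (leP n.+1%:R t) => /= h h1; rewrite ler_norml; lra.
Qed.

(* Step functions are uniformly dense, so a comparison on indicators extends. *)
Lemma poslin_le_indic F1 F2 : poslin F1 -> poslin F2 ->
  (forall A, measurable A -> F1 \1_A <= F2 \1_A) ->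
  forall f, bounded_measurable f -> (forall x, 0 <= f x) -> F1 f <= F2 f.
Proof.
move=> p1 p2 F12 f bf f0.
have /bounded_measurableP[mf [B fB]] := bf.
have K0 : 0 <= F1 (fun=> 1) + F2 (fun=> 1).
  by rewrite addr_ge0// ?(p1.2, p2.2)//; exact: bounded_measurable_cst.
set K := F1 (fun=> 1) + _ in K0 *.
have C0 : 0 < `|B| + 1 by have := normr_ge0 B; lra.
set C := `|B| + 1 in C0.
have key (N : nat) : (0 < N)%N -> F1 f <= F2 f + C / N%:R * K.
  move=> N0; have N0' : 0 < N%:R :> R by rewrite ltr0n.
  (* Mesh of the approximation: [e * s x] is [f x] rounded down to a multiple of [e]. The [N] levels
     suffice because [N * e = C] exceeds every value of [f]. *)
  pose e := C / N%:R.
  have e0 : 0 < e by rewrite divr_gt0.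
  pose A (i : nat) := [set x | i.+1%:R * e <= f x].
  have mA i : measurable (A i).
    rewrite /A (_ : [set _ | _] = [set: E] `&` f @^-1` `[i.+1%:R * e, +oo[).
      exact: mf.
    by rewrite setTI; apply/seteqP; split=> x /=; rewrite in_itv/= andbT.
  have bA i : bounded_measurable (\1_(A i) : E -> R).
    exact: bounded_measurable_indic.
  pose s x : R := \sum_(i < N) \1_(A i) x.
  have bs : bounded_measurable s.
    exact: (@bounded_measurable_sum N (fun i => \1_(A i) : E -> R)).
  have bes : bounded_measurable (fun x => e * s x).
    exact: bounded_measurableZ.
  have fs x : `|f x - e * s x| <= e.
    have -> : f x - e * s x = e * (f x / e - s x).
      by rewrite mulrBr mulrCA divff ?gt_eqF// mulr1.
    rewrite normrM gtr0_norm// -[leRHS]mulr1 ler_wpM2l ?(ltW e0)//.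
    have -> : s x = \sum_(i < N) (i.+1%:R <= f x / e)%R%:R.
      apply: eq_bigr => i _; rewrite indicE; congr (nat_of_bool _)%:R.
      rewrite ler_pdivlMr//.
      by apply/idP/idP; rewrite inE.
    apply: sum_steps_approx; rewrite divr_ge0 ?(ltW e0)//= ler_pdivrMr// /e.
    rewrite mulrCA divff ?gt_eqF// mulr1.
    by have := fB x; have := ler_norm (f x); have := ler_norm B; rewrite /C; lra.
  have D F : poslin F -> `|F f - e * F s| <= e * F (fun=> 1).
    move=> pF; rewrite -poslinZ// -poslinB// -poslin_cst//.
    apply: poslin_norm_le => //; last exact: bounded_measurable_cst.
    exact: bounded_measurableB.
  have F12s : e * F1 s <= e * F2 s.
    rewrite ler_wpM2l ?(ltW e0)//.
    rewrite !(@poslin_sum _ _ N (fun i => \1_(A i) : E -> R))//.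
    by apply: ler_sum => i _; exact: F12.
  have := D _ p1; have := D _ p2; rewrite !ler_norml => /andP[a _] /andP[_ b].
  by rewrite /K mulrDr; rewrite -/e; lra.
apply/ler_addgt0Pr => r r0.
(* [N] exceeds [C * K / r], so the error [C / N * K] is at most [r]. *)
pose N := (Num.truncn (C * K / r)).+1.
apply: (le_trans (key N _)) => //; rewrite lerD2l.
have : C * K / r < N%:R by rewrite truncnS_gt.
rewrite ltr_pdivrMr// => h.
by rewrite mulrAC ler_pdivrMr ?ltr0n// [leRHS]mulrC ltW.
Qed.

(** Two comparisons settle nonnegative functions, and adding a bound [B] reduces the general case to
    these. The integration identities below are all proved on indicators and extended by this
    lemma. *)
Lemma poslin_eq_indic F1 F2 : poslin F1 -> poslin F2 ->
  (forall A, measurable A -> F1 \1_A = F2 \1_A) ->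
  forall f, bounded_measurable f -> F1 f = F2 f.
Proof.
move=> p1 p2 F12.
have H f : bounded_measurable f -> (forall x, 0 <= f x) -> F1 f = F2 f.
  move=> bf f0; apply/le_anti/andP; split; apply: poslin_le_indic => // A mA;
  by rewrite F12.
move=> f bf; have /bounded_measurableP[mf [B fB]] := bf.
have b1 := bounded_measurable_cst 1; have bB := bounded_measurable_cst B.
have e F : poslin F -> F f = F (fun x => f x + B) - B * F (fun=> 1).
  by move=> pF; rewrite poslinD// (poslin_cst pF B) addrK.
rewrite (e _ p1) (e _ p2) (H (fun=> 1))// H//.
  exact: bounded_measurableD.
by move=> x; have := fB x; rewrite ler_norml => /andP[]; lra.
Qed.

End positive_functionals.

(** * Positive operators and their iterates *)

Section positive_operators.
Context d (E : measurableType d) (R : realType).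
Implicit Types (f g : E -> R) (F : (E -> R) -> R) (T : (E -> R) -> E -> R).

Definition posop T :=
  (forall f, bounded_measurable f -> bounded_measurable (T f)) /\
  (forall x, poslin (T ^~ x)).

Lemma poslin_comp F T : poslin F -> posop T -> poslin (fun f => F (T f)).
Proof.
move=> pF [bT pT]; split=> [a f g bf bg|f bf f0].
  rewrite -pF.1; [|exact: bT|exact: bT].
  by congr F; apply/funext => x; rewrite (pT x).1.
by apply: pF.2 => [|x]; [exact: bT|exact: (pT x).2].
Qed.

Lemma posop_iter T n : posop T -> posop (iter n T).
Proof.
move=> pT; elim: n => [|n [bn pn]].
  by split=> // x; split=> // f _; exact.
split=> [f bf|x]; first by rewrite iterS; apply: pT.1; exact: bn.
exact: (poslin_comp (pT.2 x) (conj bn pn)).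
Qed.

End positive_operators.

(** * Integrals against measures and kernels *)

Section integrals.
Context d (E : measurableType d) (R : realType).
Implicit Types (f g : E -> R) (nu : {measure set E -> \bar R}).

Lemma poslin_int nu : (nu [set: E] < +oo)%E ->
  poslin (fun f => \int[nu]_x f x).
Proof.
move=> nuoo.
have it f : bounded_measurable f -> nu.-integrable [set: E] (EFin \o f).
  by case=> mf bf; exact: measurable_bounded_integrable.
split=> [a f g bf bg|f bf f0]; last exact: Rintegral_ge0.
rewrite RintegralD//; last exact: it.
  by rewrite RintegralZl//; exact: it.
by apply: (it (fun x => a * f x)); exact: bounded_measurableZ.
Qed.

Lemma Rintegral_indic_setT nu A : measurable A ->
  \int[nu]_x \1_A x = fine (nu A).
Proof. by move=> mA; rewrite /Rintegral integral_indic// setIT. Qed.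

Lemma Rintegral1 nu : \int[nu]_x 1 = fine (nu [set: E]).
Proof. by rewrite Rintegral_cst// mul1r. Qed.

Lemma le_measureT_fin_num nu A : (nu [set: E] < +oo)%E -> measurable A ->
  nu A \is a fin_num.
Proof.
move=> nuoo mA; rewrite ge0_fin_numE//.
by rewrite (le_lt_trans _ nuoo)// le_measure ?inE.
Qed.

Definition kop (K : R.-ker E ~> E) (f : E -> R) (x : E) : R := \int[K x]_y f y.

Definition mass_le (K : R.-ker E ~> E) (C : R) :=
  forall x, (K x [set: E] <= C%:E)%E.

Section bounded_kernel.
Variables (K : R.-ker E ~> E) (C : R) (KC : mass_le K C).

Let Koo x : (K x [set: E] < +oo)%E.
Proof. exact: le_lt_trans (KC x) (ltry _). Qed.

Lemma kop1_le x : kop K (fun=> 1) x <= C.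
Proof.
rewrite /kop Rintegral1 -lee_fin fineK// le_measureT_fin_num//.
Qed.

Lemma kop_norm_le f x B : bounded_measurable f ->
  (forall y, `|f y| <= B) -> `|kop K f x| <= B * C.
Proof.
move=> bf fB; have pK := poslin_int (Koo x).
apply: (@le_trans _ _ (kop K (fun=> B) x)).
  by apply: poslin_norm_le => //; exact: bounded_measurable_cst.
rewrite /kop [leLHS](poslin_cst pK) ler_wpM2l ?kop1_le//.
by rewrite (le_trans _ (fB point)).
Qed.

Lemma posop_kop : posop (kop K).
Proof.
split=> [f bf|x]; last exact: poslin_int.
have /bounded_measurableP[mf [B fB]] := bf.
apply/bounded_measurableP; split; last first.
  by exists (B * C) => x; exact: kop_norm_le.
have H g : bounded_measurable g -> (forall x, 0 <= g x) ->
    measurable_fun [set: E] (kop K g).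
  move=> [mg _] g0; apply: measurableT_comp => //=.
  apply: (@measurable_fun_integral_kernel _ _ _ _ _ _ _ (EFin \o g)).
  - by move=> U mU; exact: measurable_kernel.
  - by move=> z /=; rewrite lee_fin.
  - exact/measurable_EFinP.
have bB := bounded_measurable_cst E B.
(* Measurability of a kernel integral is available for nonnegative integrands; [f + B] and [B] are
   such. *)
rewrite (_ : kop K f = fun x => kop K (fun y => f y + B) x - kop K (fun=> B) x).
  apply: measurable_funB.
    apply: H; first exact: bounded_measurableD.
    by move=> x; have := fB x; rewrite ler_norml => /andP[]; lra.
  apply: H => // _; exact: le_trans (fB point).
by apply/funext => x; rewrite [X in X - _](poslinD (poslin_int (Koo x)))// addrK.
Qed.

Lemma mact_fin nu : (nu [set: E] < +oo)%E -> (mact nu K [set: E] < +oo)%E.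
Proof.
move=> nuoo; rewrite /mact.
apply: (@le_lt_trans _ _ (\int[nu]_x C%:E)%E).
  by apply: ge0_le_integral => //; exact: measurable_kernel.
rewrite (_ : (\int[nu]_x C%:E)%E = (C%:E * nu [set: E])%E); last first.
  exact: integral_cst.
have [->|] := eqVneq (nu [set: E]) 0; first by rewrite mule0 ltry.
by move=> _; rewrite -(@fineK _ (nu [set: E])) ?le_measureT_fin_num// -EFinM ltry.
Qed.

(** On indicators this is the definition of [mact]. The mass bounds keep every value finite, so that
    [fine] loses nothing. *)
Lemma Rintegral_mact nu f : (nu [set: E] < +oo)%E -> bounded_measurable f ->
  \int[mact nu K]_x f x = \int[nu]_x kop K f x.
Proof.
move=> nuoo; move: f; apply: poslin_eq_indic.
- exact: poslin_int (mact_fin nuoo).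
- exact: poslin_comp (poslin_int nuoo) posop_kop.
move=> A mA; rewrite Rintegral_indic_setT//= /mact /Rintegral.
congr fine; apply: eq_integral => x _.
rewrite /kop Rintegral_indic_setT// fineK//.
exact: le_measureT_fin_num.
Qed.

End bounded_kernel.

Lemma Rintegral_measure_eq (m1 m2 : {measure set E -> \bar R}) f :
  measure_eq m1 m2 -> \int[m1]_x f x = \int[m2]_x f x.
Proof.
move=> m12; rewrite /Rintegral; congr fine.
by apply: eq_measure_integral => A mA _; exact: m12.
Qed.

Lemma mass_le_kpow (K : R.-ker E ~> E) C n :
  mass_le K C -> mass_le (kpow K n) (C ^+ n).
Proof.
move=> KC; elim: n => [|n IH] x.
  by rewrite /= /kdirac/= diracT expr0.
have nx : (kpow K n x [set: E] < +oo)%E by exact: le_lt_trans (IH x) (ltry _).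
have C0 : 0 <= C by rewrite -lee_fin (le_trans _ (KC point)).
rewrite -(@fineK _ (kpow K n.+1 x [set: E])); last first.
  by apply: le_measureT_fin_num => //; exact: mact_fin KC _ nx.
rewrite lee_fin -Rintegral1 (Rintegral_mact KC)//; last exact: bounded_measurable_cst.
apply: (@le_trans _ _ (\int[kpow K n x]_y C)).
  apply: (poslin_le (poslin_int nx)) => [||y].
  - by apply: (posop_kop KC).1; exact: bounded_measurable_cst.
  - exact: bounded_measurable_cst.
  - exact: kop1_le.
rewrite Rintegral_cst// exprS ler_wpM2l//.
by rewrite -lee_fin fineK ?le_measureT_fin_num.
Qed.

Lemma kop_kpow (K : R.-ker E ~> E) C n f : mass_le K C ->
  bounded_measurable f -> kop (kpow K n) f = iter n (kop K) f.
Proof.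
move=> KC; elim: n f => [|n IH] f bf.
  have mf : measurable_fun [set: E] (EFin \o f).
    by apply/measurable_EFinP; exact: bf.1.
  apply/funext => x; rewrite /kop /= /Rintegral /kdirac.
  by rewrite (integral_dirac x measurableT mf) diracT mul1e.
(* [kpow] adds its new factor on the right, so the application of [kop K] next to [f] is the one to
   peel off. *)
rewrite iterSr -IH; last exact: (posop_kop KC).1.
apply/funext => x; rewrite {1}/kop (Rintegral_mact KC)//.
exact: le_lt_trans (mass_le_kpow _ KC _) (ltry _).
Qed.

Lemma measure_add_measureE (m1 m2 : {measure set E -> \bar R}) A :
  (measure_add m1 m2 : {measure set E -> \bar R}) A = (m1 A + m2 A)%E.
Proof. exact: measure_addE. Qed.

Lemma Rintegral_measure_add (m1 m2 : {measure set E -> \bar R}) f :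
  (m1 [set: E] < +oo)%E -> (m2 [set: E] < +oo)%E -> bounded_measurable f ->
  \int[measure_add m1 m2]_x f x = \int[m1]_x f x + \int[m2]_x f x.
Proof.
move=> m1oo m2oo; move: f; apply: poslin_eq_indic.
- apply: poslin_int; by rewrite measure_add_measureE lte_add_pinfty.
- have := poslin_comb ler01 (poslin_int m1oo) (poslin_int m2oo).
  by congr poslin; apply/funext => f; rewrite mul1r.
move=> A mA; rewrite !Rintegral_indic_setT// measure_add_measureE fineD//;
exact: le_measureT_fin_num.
Qed.

Lemma Rintegral_mnormalize nu (P : probability E R) f :
  (0 < nu [set: E])%E -> (nu [set: E] < +oo)%E -> bounded_measurable f ->
  \int[mnormalize nu P]_x f x = (\int[nu]_x f x) / (\int[nu]_x 1).
Proof.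
move=> nu0 nuoo; rewrite Rintegral1.
have nu0' : 0 < fine (nu [set: E]) by rewrite fine_gt0// nu0.
move: f; apply: poslin_eq_indic.
- apply: poslin_int; apply: (@le_lt_trans _ _ 1%E); last exact: ltry.
  exact: probability_le1.
- split=> [a f g bf bg|f bf f0].
    by rewrite (poslin_int nuoo).1// mulrDl mulrA.
  by rewrite divr_ge0 ?(ltW nu0')//; exact: (poslin_int nuoo).2.
move=> A mA; rewrite !Rintegral_indic_setT//.
transitivity (fine (nu A * ((fine (nu [set: E]))^-1)%:E)%E).
  congr fine; rewrite -[LHS]/(mnormalize nu P A) /mnormalize.
  (* The mass is neither 0 nor [+oo], so the default value [P] is not selected. *)
  by rewrite /= gt_eqF//= lt_eqF.
by rewrite -(@fineK _ (nu A)) ?le_measureT_fin_num//.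
Qed.

End integrals.

(** * Closed form of the measure flow *)

Section flow.
Context d (E : measurableType d) (R : realType).
Variables (Q : R.-ker E ~> E) (C : R) (QC : mass_le Q C).
Variables (mu gamma0 : {measure set E -> \bar R}).
Hypothesis muoo : (mu [set: E] < +oo)%E.
Hypothesis gamma0oo : (gamma0 [set: E] < +oo)%E.

Lemma gamma_seq_fin n : (gamma_seq Q mu gamma0 n [set: E] < +oo)%E.
Proof.
elim: n => [//|n IH]; rewrite measure_add_measureE lte_add_pinfty//.
exact: mact_fin QC _ IH.
Qed.

Lemma Rintegral_gamma_seqS n f : bounded_measurable f ->
  \int[gamma_seq Q mu gamma0 n.+1]_x f x =
  \int[gamma_seq Q mu gamma0 n]_x kop Q f x + \int[mu]_x f x.
Proof.
move=> bf; have gn := gamma_seq_fin n.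
rewrite Rintegral_measure_add//; last exact: mact_fin QC _ gn.
by rewrite (Rintegral_mact QC).
Qed.

(** Duhamel formula: births of age [i] have been transported by [Q^i]. The induction varies [f],
    because the last step acts on it; the newest births give the term [i = 0]. *)
Lemma Rintegral_gamma_seq n f : bounded_measurable f ->
  \int[gamma_seq Q mu gamma0 n]_x f x =
  \int[gamma0]_x iter n (kop Q) f x + \sum_(i < n) \int[mu]_x iter i (kop Q) f x.
Proof.
elim: n f => [|n IH] f bf; first by rewrite big_ord0 addr0.
rewrite Rintegral_gamma_seqS// IH; last exact: (posop_kop QC).1.
rewrite -iterSr big_ord_recl -addrA; congr +%R; rewrite addrC; congr +%R.
by apply: eq_bigr => i _; rewrite -iterSr.
Qed.

Lemma gamma_termE n f : bounded_measurable f ->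
  gamma_term Q mu f n = \int[mu]_x iter n (kop Q) f x.
Proof.
move=> bf; rewrite /gamma_term (Rintegral_mact (mass_le_kpow n QC))//.
by rewrite (kop_kpow _ QC).
Qed.

End flow.

(** * A positive functional dominated by a finite measure is a measure *)

Section dominated_functional.
Context d (E : measurableType d) (R : realType).
Variables (L : (E -> R) -> R) (nu : {measure set E -> \bar R}) (C : R).
Hypotheses (pL : poslin L) (nuoo : (nu [set: E] < +oo)%E) (C0 : 0 <= C).
Hypothesis Lnu : forall f, bounded_measurable f -> (forall x, 0 <= f x) ->
  L f <= C * \int[nu]_x f x.

(* The absolute value only makes the set function nonnegative outside the
   sigma-algebra. *)
Let m (A : set E) : \bar R := (`|L \1_A|)%:E.

Let mE A : measurable A -> m A = (L \1_A)%:E.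
Proof.
move=> mA; congr EFin; rewrite ger0_norm//; apply: pL.2 => [|x].
  exact: bounded_measurable_indic.
by rewrite indicE ler0n.
Qed.

Let m0 : m set0 = 0%E.
Proof.
rewrite mE//; congr EFin; rewrite -[RHS](poslin0 pL); congr L.
by apply/funext => x; rewrite indic0.
Qed.

Let m_ge0 A : (0 <= m A)%E. Proof. by rewrite lee_fin. Qed.

(** The remainder [g n], the indicator of the union minus the first [n] indicators, is nonnegative.
    Hence [0 <= L (g n) <= C * nu (g n)], and countable additivity of [nu] sends the right-hand side
    to 0. *)
Let m_sigma_additive : semi_sigma_additive m.
Proof.
move=> F mF tF mUF.
have bF i : bounded_measurable (\1_(F i) : E -> R).
  exact: bounded_measurable_indic.
have bU : bounded_measurable (\1_(\bigcup_n F n) : E -> R).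
  exact: bounded_measurable_indic.
pose g n (x : E) : R := \1_(\bigcup_n F n) x - \sum_(i < n) \1_(F i) x.
have bS n : bounded_measurable (fun x => \sum_(i < n) \1_(F i) x : R).
  exact: (@bounded_measurable_sum _ _ _ n (fun i => \1_(F i) : E -> R)).
have bg n : bounded_measurable (g n) by exact: bounded_measurableB.
have g0 n x : 0 <= g n x.
  rewrite /g subr_ge0 -lee_fin indic_bigcup// -sumEFin.
  rewrite -(big_mkord xpredT (fun i => (\1_(F i) x)%:E)).
  by apply: nneseries_lim_ge => i _ _; rewrite lee_fin indicE ler0n.
have gE F' n : poslin F' ->
    F' (g n) = F' \1_(\bigcup_n F n) - \sum_(i < n) F' \1_(F i).
  move=> p; rewrite /g (poslinB p)//.
  by rewrite (@poslin_sum _ _ _ _ p n (fun i => \1_(F i) : E -> R)).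
pose nug n := fine (nu (\bigcup_n F n)) - \sum_(0 <= i < n) fine (nu (F i)).
have nug0 : nug @ \oo --> 0.
  rewrite -[X in _ --> X](subrr (fine (nu (\bigcup_n F n)))).
  apply: cvgB; first exact: cvg_cst.
  have := @measure_semi_sigma_additive _ _ _ nu F mF tF mUF.
  rewrite -(fineK (le_measureT_fin_num nuoo mUF)) => /fine_cvg.
  apply: cvg_trans; apply: near_eq_cvg; apply: nearW => n /=.
  rewrite sum_fine// => i _; exact: le_measureT_fin_num.
have Lg n : L (g n) <= C * nug n.
  apply: (le_trans (Lnu (bg n) (g0 n))); rewrite ler_wpM2l// /nug.
  rewrite (gE (fun f => \int[nu]_x f x))//; last exact: poslin_int.
  rewrite !Rintegral_indic_setT// big_mkord.
  by under eq_bigr do rewrite Rintegral_indic_setT//.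
rewrite (_ : (fun n => _) = EFin \o (fun n => L \1_(\bigcup_n F n) - L (g n))).
  rewrite mE//; apply: cvg_EFin; first exact: nearW.
  rewrite -[X in _ --> X]subr0; apply: cvgB; first exact: cvg_cst.
  apply: (@squeeze_cvgr _ _ _ _ (cst 0) (fun n => C * nug n)).
  - by apply: nearW => n; rewrite /= (pL.2 _ (bg n) (g0 n)) Lg.
  - exact: cvg_cst.
  - by rewrite -[X in _ --> X](mulr0 C); apply: cvgMr.
apply/funext => n /=; rewrite (gE L)// subKr -sumEFin big_mkord.
by apply: eq_bigr => i _; rewrite mE.
Qed.

Lemma dominated_poslin_measure : exists P : {measure set E -> \bar R},
  forall A, measurable A -> P A = (L \1_A)%:E.
Proof.
pose P : {measure set E -> \bar R} := HB.pack m
  (isMeasure.Build _ _ _ m m0 m_ge0 m_sigma_additive).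
by exists P => A mA; rewrite -mE.
Qed.

Lemma dominated_poslin_probability : L (fun=> 1) = 1 ->
  exists P : probability E R,
    forall f, bounded_measurable f -> \int[P]_x f x = L f.
Proof.
move=> L1; have [P PL] := dominated_poslin_measure.
have P1 : P [set: E] = 1%E.
  rewrite PL// -L1; congr (L _)%:E.
  by apply/funext => x; rewrite indicT.
(* [P] already has mass 1; normalizing leaves its values unchanged and only supplies the structure
   of a probability. *)
exists (mnormalize P point) => f bf.
rewrite Rintegral_mnormalize ?P1 ?lte01 ?ltry// Rintegral1 P1 divr1.
move: f bf; apply: poslin_eq_indic => //; first by apply: poslin_int; rewrite P1 ltry.
by move=> A mA; rewrite Rintegral_indic_setT// PL.
Qed.

End dominated_functional.

(** * Elementary real estimates *)

Section real_lemmas.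
Context (R : realType).

(** Bernoulli's inequality converts a contraction per block of [k] steps into a rate per step
    without extracting a root. *)
Lemma bernoulli_subr (y : R) n : 0 <= y <= 1 -> 1 - n%:R * y <= (1 - y) ^+ n.
Proof.
move=> /andP[y0 y1]; elim: n => [|n IH]; first by rewrite mul0r subr0 expr0.
rewrite exprS; apply: (@le_trans _ _ ((1 - y) * (1 - n%:R * y))).
  have ny : 0 <= n%:R * (y * y) by rewrite !mulr_ge0.
  have -> : (1 - y) * (1 - n%:R * y) = 1 - y - n%:R * y + n%:R * (y * y) by ring.
  by rewrite -natr1 mulrDl mul1r; lra.
by rewrite ler_wpM2l// subr_ge0.
Qed.

Lemma geometric_sum_le (q : R) n : 1 < q ->
  \sum_(i < n) q ^+ i <= q ^+ n / (q - 1).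
Proof.
move=> q1; rewrite ler_pdivlMr ?subr_gt0// mulrC -subrX1.
by rewrite lerBlDr lerDl.
Qed.

(** For [n > 0] the quantity [n^-1 * ln (c * t ^+ n)] equals [n^-1 * ln c + ln t], so the constants
    [a] and [b] vanish in the limit and a squeeze applies. *)
Lemma cvg_ln_div_geometric (m : nat -> R) a b t : 0 < a -> 0 < t ->
  (forall n, a * t ^+ n <= m n <= b * t ^+ n) ->
  (fun n => n%:R^-1 * ln (m n)) @ \oo --> ln t.
Proof.
move=> a0 t0 mab.
have tn0 n : 0 < t ^+ n by rewrite exprn_gt0.
have m0 n : 0 < m n.
  by have /andP[+ _] := mab n; apply: lt_le_trans; rewrite mulr_gt0.
have b0 : 0 < b.
  have /andP[_] := mab 0%N; rewrite expr0 mulr1; exact: lt_le_trans (m0 0%N).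
have C c : (fun n : nat => n%:R^-1 * ln c + ln t) @ \oo --> ln t.
  rewrite -[X in _ --> X]add0r -[X in X + _](mul0r (ln c)).
  apply: cvgD; last exact: cvg_cst.
  apply: cvgMl; rewrite -(@cvg_shiftS _ _ _); exact: cvg_harmonic.
apply: (squeeze_cvgr _ (C a) (C b)).
near=> n.
have n0 : (0 < n)%N by near: n; exact: nbhs_infty_gt.
have n0' : 0 < n%:R :> R by rewrite ltr0n.
have /andP[ma mb] := mab n.
have E c : 0 < c -> n%:R^-1 * ln c + ln t = n%:R^-1 * ln (c * t ^+ n).
  move=> c0; rewrite lnM ?posrE// lnXn// mulrDr; congr +%R.
  by rewrite -[ln t *+ n]mulr_natl mulrA mulVf ?mul1r// gt_eqF.
rewrite !E// !ler_wpM2l ?invr_ge0// ?ler_ln ?posrE ?mulr_gt0//.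
Unshelve. all: by end_near.
Qed.

End real_lemmas.

(** * Contraction of ratios under a two-sided minorization *)

Section perron_frobenius.
Context d (E : measurableType d) (R : realType).
Variables (T : (E -> R) -> E -> R) (pT : posop T).
Variables (k : nat) (k1 : (1 <= k)%N) (del gm gp : R).
Hypotheses (del0 : 0 < del) (gm1 : 1 < gm).
Hypotheses (gmT : forall x, gm <= T (fun=> 1) x).
Hypotheses (gpT : forall x, T (fun=> 1) x <= gp).
Hypothesis minor : forall u, bounded_measurable u -> (forall x, 0 <= u x) ->
  forall x y, del * iter k T u y <= iter k T u x.
Implicit Types (f : E -> R) (n : nat).

Local Notation h n := (iter n T (fun=> 1)).

Let b1 : bounded_measurable (fun _ : E => 1 : R).
Proof. exact: bounded_measurable_cst. Qed.

Let bT n f : bounded_measurable f -> bounded_measurable (iter n T f).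
Proof. exact: (posop_iter n pT).1. Qed.

Let pTn n x : poslin (fun f => iter n T f x).
Proof. exact: (posop_iter n pT).2. Qed.

Let gp0 : 1 < gp.
Proof. by rewrite (lt_le_trans gm1)// (le_trans (gmT point)). Qed.

Let h_geS n x : h n x <= h n.+1 x.
Proof.
rewrite iterSr; apply: (poslin_le (pTn n x)) => //; first exact: pT.1.
by move=> y; rewrite (le_trans (ltW gm1)).
Qed.

Let h_ge m n x : h n x <= h (m + n) x.
Proof. by elim: m => // m IH; rewrite addSn (le_trans IH). Qed.

Let h_ge1 n x : 1 <= h n x.
Proof. by have := h_ge n 0 x; rewrite addn0. Qed.

Let h_gt0 n x : 0 < h n x.
Proof. exact: lt_le_trans (h_ge1 n x). Qed.

Let h_le m n x : h (m + n) x <= gp ^+ m * h n x.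
Proof.
elim: m => [|m IH]; first by rewrite expr0 mul1r.
rewrite addSn iterSr; apply: (@le_trans _ _ (iter (m + n) T (fun=> gp) x)).
  apply: (poslin_le (pTn _ x)) => //; first exact: pT.1.
  exact: bounded_measurable_cst.
by rewrite (poslin_cst (pTn _ x)) exprS -mulrA ler_wpM2l// ltW// (lt_trans _ gp0).
Qed.

Lemma minor_le1 : del <= 1.
Proof.
have := minor b1 (fun=> ler01) point point.
by rewrite -[leRHS]mul1r ler_pM2r.
Qed.

Let h_minor n x y : del * h (k + n) y <= h (k + n) x.
Proof. by rewrite !iterD; apply: minor => [|z]; [exact: bT|rewrite ltW]. Qed.

(** Bounds for the ratios [T^n f / T^n 1] over all points. The form without division is linear, so
    positive operators can be applied to it. *)
Definition sandwich n f a A := forall x, a * h n x <= iter n T f x <= A * h n x.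

(** The positive operator [T^m] preserves both inequalities, so the intervals of ratios are nested
    in time. *)
Lemma sandwichD m n f a A : bounded_measurable f ->
  sandwich n f a A -> sandwich (m + n) f a A.
Proof.
move=> bf sf x; rewrite !iterD -!(poslinZ (pTn m x)); try exact: bT.
apply/andP; split; apply: (poslin_le (pTn m x)); try exact: bT.
- by apply/bounded_measurableZ/bT.
- by move=> y; have /andP[] := sf y.
- by apply/bounded_measurableZ/bT.
- by move=> y; have /andP[] := sf y.
Qed.

Lemma sandwich_le n f a A : sandwich n f a A -> a <= A.
Proof.
move=> /(_ point)/andP[h1 h2].
by have := le_trans h1 h2; rewrite ler_pM2r.
Qed.

(* One of the two gaps is at least half of the width at a given point, hence by
   minorization everywhere up to the factor del ^+ 2. *)
Lemma sandwich_contract n f a A : bounded_measurable f ->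
  sandwich n f a A -> exists a' A', sandwich (k + n) f a' A' /\
    A' - a' <= (1 - del ^+ 2 / 2) * (A - a).
Proof.
move=> bf sf; have aA := sandwich_le sf; have skf := sandwichD k bf sf.
pose e := del ^+ 2 / 2 * (A - a).
have bTf := bT n bf; have bh := bT n b1.
pose u x := iter n T f x - a * h n x.
pose v x := A * h n x - iter n T f x.
have bu : bounded_measurable u.
  by apply: bounded_measurableB => //; exact: bounded_measurableZ.
have bv : bounded_measurable v.
  by apply: bounded_measurableB => //; exact: bounded_measurableZ.
have u0 x : 0 <= u x by rewrite subr_ge0; have /andP[] := sf x.
have v0 x : 0 <= v x by rewrite subr_ge0; have /andP[] := sf x.
have Hu x : iter k T u x = iter (k + n) T f x - a * h (k + n) x.
  rewrite (poslinB (pTn k x))//; last exact: bounded_measurableZ.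
  by rewrite (poslinZ (pTn k x))// !iterD.
have Hv x : iter k T v x = A * h (k + n) x - iter (k + n) T f x.
  rewrite (poslinB (pTn k x))//; last exact: bounded_measurableZ.
  by rewrite (poslinZ (pTn k x))// !iterD.
have key w : bounded_measurable w -> (forall x, 0 <= w x) ->
    (A - a) / 2 * h (k + n) point <= iter k T w point ->
    forall x, e * h (k + n) x <= iter k T w x.
  (* One factor [del] moves [T^k w] from [point] to [x]; the other, from [h_minor], moves
     [h (k + n)] from [x] to [point]. The factor 1/2 is the share of the width seen at [point]. *)
  move=> bw w0 ww x; apply: le_trans (minor bw w0 x point).
  rewrite /e; apply: (@le_trans _ _ (del * ((A - a) / 2 * h (k + n) point))).
    have -> : del ^+ 2 / 2 * (A - a) * h (k + n) x =
      del * ((A - a) / 2) * (del * h (k + n) x) by field.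
    rewrite [leRHS]mulrA ler_wpM2l// mulr_ge0 ?(ltW del0)// divr_ge0// subr_ge0//.
  by rewrite ler_wpM2l// ltW.
(* Since [u + v = (A - a) * h n], one of [T^k u], [T^k v] carries at least half at [point].
   Accordingly the lower bound rises, or the upper bound drops, by [e]. *)
have [hu|hu] := leP ((A - a) / 2 * h (k + n) point) (iter k T u point).
  exists (a + e), A; split; last by rewrite /e; lra.
  move=> x; have /andP[_ ->] := skf x; rewrite andbT.
  by have := key _ bu u0 hu x; rewrite Hu mulrDl; lra.
exists a, (A - e); split; last by rewrite /e; lra.
move=> x; have /andP[-> _] /= := skf x.
suff /(key _ bv v0)/(_ x) : (A - a) / 2 * h (k + n) point <= iter k T v point.
  by rewrite Hv mulrBl; lra.
by move: hu; rewrite Hu Hv; lra.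
Qed.

Section decay.
Variables (rho : R).
Hypotheses (rho0 : 0 < rho) (rho1 : rho < 1).
Hypothesis rhok : 1 - del ^+ 2 / 2 <= rho ^+ k.

(** Strong induction by blocks of [k] steps, each contracting the width by [rho ^+ k]. The prefactor
    [(rho ^+ k)^-1] pays for an incomplete block, during which the interval is merely kept. *)
Lemma sandwich_decay f a A n : bounded_measurable f ->
  sandwich 0 f a A -> exists a' A', sandwich n f a' A' /\
    A' - a' <= (rho ^+ k)^-1 * rho ^+ n * (A - a).
Proof.
move=> bf sf; have rk0 : 0 < rho ^+ k by rewrite exprn_gt0.
have Aa : 0 <= A - a by rewrite subr_ge0 (sandwich_le sf).
have [m] := ubnP n; elim: m n => // m IH n; rewrite ltnS => nm.
have [nk|kn] := ltnP n k.
  exists a, A; split; first by have := sandwichD n bf sf; rewrite addn0.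
  rewrite -[leLHS]mul1r ler_wpM2r// mulrC ler_pdivlMr// mul1r.
  by apply: ler_wiXn2l; rewrite ?(ltW rho0) ?(ltW rho1) ?(ltnW nk).
have nk : (n - k < m)%N.
  by rewrite (leq_trans _ nm)// ltn_subrL k1 (leq_trans k1 kn).
have [a1 [A1 [s1 w1]]] := IH _ nk.
have [a2 [A2 [s2 w2]]] := sandwich_contract bf s1.
exists a2, A2; split; first by rewrite subnKC in s2.
apply: (le_trans w2); apply: (@le_trans _ _ (rho ^+ k * (A1 - a1))).
  by rewrite ler_wpM2r// subr_ge0 (sandwich_le s1).
apply: le_trans (ler_wpM2l (ltW rk0) w1) _.
rewrite -[X in _ <= _ * rho ^+ X * _](subnKC kn) exprD le_eqVlt.
by apply/orP; left; apply/eqP; ring.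
Qed.

Definition ratio f n := iter n T f point / h n point.

Lemma sandwich_ratio n f a A : sandwich n f a A -> a <= ratio f n <= A.
Proof.
by move=> /(_ point); rewrite /ratio ler_pdivlMr// ler_pdivrMr.
Qed.

Lemma sandwich_ratioD m n f a A : bounded_measurable f -> (n <= m)%N ->
  sandwich n f a A -> a <= ratio f m <= A.
Proof.
move=> bf nm sf; apply: sandwich_ratio.
by rewrite -(subnK nm); exact: sandwichD.
Qed.

Lemma sandwich0_bounded f : bounded_measurable f ->
  exists B, 0 <= B /\ sandwich 0 f (- B) B.
Proof.
move=> /bounded_measurableP[_ [B fB]]; exists B; split.
  by rewrite (le_trans _ (fB point)).
by move=> x /=; rewrite !mulr1 -ler_norml.
Qed.

(** Normalized left Perron-Frobenius eigenfunctional of [T], with eigenvalue [pf (T 1)] by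
    [pf_op]. *)
Definition pf f : R := limn (ratio f).

Let rho_small e C : 0 < e -> 0 <= C -> exists n, C * rho ^+ n <= e.
Proof.
move=> e0 C0; have : (fun n => C * rho ^+ n) @ \oo --> 0.
  rewrite -[X in _ --> X](mulr0 C); apply: cvgMr.
  by apply: cvg_expr; rewrite gtr0_norm.
move=> /cvgr0_norm_le/(_ e e0)[N _ HN]; exists N.
exact: le_trans (ler_norm _) (HN N (leqnn N)).
Qed.

(** From time [n] on, the ratios stay in one interval whose width tends to 0 with [n], so they form
    a Cauchy sequence. *)
Lemma ratio_cvg f : bounded_measurable f -> ratio f @ \oo --> pf f.
Proof.
move=> bf; apply/cauchy_cvgP/cauchy_exP => e e0.
have [B [B0 sB]] := sandwich0_bounded bf.
have C0 : 0 <= (rho ^+ k)^-1 * (B - - B).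
  by rewrite mulr_ge0 ?invr_ge0 ?exprn_ge0 ?(ltW rho0)// opprK addr_ge0.
have e20 : 0 < e / 2 by rewrite divr_gt0.
have [n hn] := rho_small e20 C0.
have [a [A [s w]]] := sandwich_decay n bf sB.
exists a; exists n => // m nm.
have /andP[l r] := sandwich_ratioD bf nm s.
rewrite /= /ball/= ltr_norml; move: w hn; rewrite mulrAC; lra.
Qed.

Lemma sandwich_pf n f a A : bounded_measurable f -> sandwich n f a A ->
  a <= pf f <= A.
Proof.
move=> bf sf; apply/andP; split.
  apply: cvgr_to_ge (ratio_cvg bf) _; exists n => // m nm.
  by have /andP[] := sandwich_ratioD bf nm sf.
apply: cvgr_to_le (ratio_cvg bf) _; exists n => // m nm.
by have /andP[] := sandwich_ratioD bf nm sf.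
Qed.

Lemma poslin_pf : poslin pf.
Proof.
split=> [a f g bf bg|f bf f0].
  apply/cvg_lim => //.
  rewrite (_ : ratio _ = fun n => a * ratio f n + ratio g n).
    by apply: cvgD; [apply: cvgMr; exact: ratio_cvg|exact: ratio_cvg].
  by apply/funext => n; rewrite /ratio (pTn n point).1// mulrDl mulrA.
have [B [B0 sB]] := sandwich0_bounded bf.
suff /(sandwich_pf bf)/andP[] : sandwich 0 f 0 B by [].
by move=> x; have /andP[_ ->] := sB x; rewrite mul0r f0.
Qed.

Lemma pf1 : pf (fun=> 1) = 1.
Proof.
have : sandwich 0 (fun=> 1) 1 1 by move=> x; rewrite mul1r lexx.
by move=> /(sandwich_pf b1) h; apply/le_anti; rewrite andbC.
Qed.

Lemma pf_cst c : pf (fun=> c) = c.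
Proof. by rewrite (poslin_cst poslin_pf) pf1 mulr1. Qed.

Local Notation theta := (pf (T (fun=> 1))).

Lemma pf_op f : bounded_measurable f -> pf (T f) = pf f * theta.
Proof.
move=> bf; apply/cvg_lim => //.
(* The factor [T^(n+1) 1] is inserted in numerator and denominator, so that both quotients
   converge. *)
rewrite (_ : ratio (T f) = fun n => ratio f n.+1 * ratio (T (fun=> 1)) n).
  apply: cvgM; last by apply: ratio_cvg; exact: pT.1.
  by rewrite (@cvg_shiftS _ (ratio f)); exact: ratio_cvg.
apply/funext => n; rewrite /ratio -!iterSr.
by rewrite mulrA divfK// gt_eqF.
Qed.

Lemma pf_iter n f : bounded_measurable f ->
  pf (iter n T f) = pf f * theta ^+ n.
Proof.
move=> bf; elim: n => [|n IH]; first by rewrite expr0 mulr1.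
by rewrite iterS pf_op ?IH ?exprSr ?mulrA//; exact: bT.
Qed.

Lemma pf_gt1 : gm <= theta.
Proof.
rewrite -[leLHS]pf_cst.
apply: (poslin_le poslin_pf) => //; first exact: bounded_measurable_cst.
exact: pT.1.
Qed.

(** Minorization bounds [T^k f] everywhere by [del^-1] times its value at [point], and [h k >= 1]
    turns this into a bound on the ratios. It provides the domination that makes [pf] countably
    additive. *)
Lemma pf_dominated f : bounded_measurable f -> (forall x, 0 <= f x) ->
  pf f <= del^-1 * iter k T f point.
Proof.
move=> bf f0.
suff /(sandwich_pf bf)/andP[] : sandwich k f 0 (del^-1 * iter k T f point) by [].
move=> x; rewrite mul0r (pTn k x).2//= (@le_trans _ _ (del^-1 * iter k T f point))//.
  by rewrite mulrC ler_pdivlMr// mulrC minor.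
rewrite -[leLHS]mulr1 ler_wpM2l// mulr_ge0 ?invr_ge0 ?(ltW del0)//.
exact: (pTn k point).2.
Qed.

(** [pf] averages [h (k + n)] to [theta ^+ (k + n)], and minorization makes the values of
    [h (k + n)] comparable up to [del]. The shift by [k] is removed by
    [h n <= h (k + n) <= gp ^+ k * h n]. *)
Lemma h_pf_bounds : exists c1 c2, [/\ 0 < c1, 0 < c2 &
  forall n x, c1 * theta ^+ n <= h n x <= c2 * theta ^+ n].
Proof.
have t0 : 0 < theta by rewrite (lt_le_trans _ pf_gt1)// (lt_trans _ gm1).
have gpk : 0 < gp ^+ k by rewrite exprn_gt0// (lt_trans _ gp0).
have pfh n : pf (h n) = theta ^+ n by rewrite pf_iter// pf1 mul1r.
exists ((gp ^+ k)^-1 * del), (del^-1 * theta ^+ k); split.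
- by rewrite mulr_gt0 ?invr_gt0.
- by rewrite mulr_gt0 ?invr_gt0 ?exprn_gt0.
move=> n x; apply/andP; split.
  rewrite -mulrA mulrC ler_pdivrMr// [leRHS]mulrC; apply: le_trans (h_le k n x).
  apply: (@le_trans _ _ (del * theta ^+ (k + n))).
    rewrite ler_wpM2l ?(ltW del0)// ler_weXn2l ?leq_addl//.
    by rewrite (le_trans _ pf_gt1)// ltW.
  rewrite -pfh -(poslinZ poslin_pf)//; last exact: bT.
  rewrite -[leRHS]pf_cst.
  apply: (poslin_le poslin_pf) => //; first by apply/bounded_measurableZ/bT.
  exact: bounded_measurable_cst.
apply: (le_trans (h_ge k n x)).
rewrite -mulrA -exprD mulrC ler_pdivlMr// mulrC -pfh.
rewrite -[leLHS]pf_cst.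
apply: (poslin_le poslin_pf) => //; first exact: bounded_measurable_cst.
exact: bT.
Qed.

(** The ratio at [x] and the limit [pf f] lie in the same contracted interval; multiplying by
    [h n x] clears the denominator. *)
Lemma iter_pf_dist f a A n x : bounded_measurable f -> sandwich 0 f a A ->
  `|iter n T f x - pf f * h n x| <=
    (rho ^+ k)^-1 * rho ^+ n * (A - a) * h n x.
Proof.
move=> bf sf; have [a' [A' [s' w]]] := sandwich_decay n bf sf.
apply: (@le_trans _ _ ((A' - a') * h n x)); last by rewrite ler_pM2r.
have /andP[l r] := sandwich_pf bf s'; have /andP[l' r'] := s' x.
have := ler_wpM2r (ltW (h_gt0 n x)) l; have := ler_wpM2r (ltW (h_gt0 n x)) r.
by rewrite ler_norml mulrBl; lra.
Qed.

Lemma poslin_iter_pf_dist (F : (E -> R) -> R) f a A n : poslin F ->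
  bounded_measurable f -> sandwich 0 f a A ->
  `|F (iter n T f) - pf f * F (h n)| <=
    (rho ^+ k)^-1 * rho ^+ n * (A - a) * F (h n).
Proof.
move=> pF bf sf; have bh := bT n b1; have bTf := bT n bf.
rewrite -!(poslinZ pF)// -(poslinB pF)//; last exact: bounded_measurableZ.
apply: (poslin_norm_le pF).
- by apply: bounded_measurableB => //; exact: bounded_measurableZ.
- exact: bounded_measurableZ.
by move=> x; exact: iter_pf_dist.
Qed.

(** Such a [P] satisfies [P (T^n f) = P f * t ^+ n]. Applying [P] to the uniform estimate and
    dividing by [t ^+ n] bounds the distance of [P f] to [pf f] by a multiple of [rho ^+ n], for
    every [n]. *)
Lemma pf_unique (P : (E -> R) -> R) : poslin P -> P (fun=> 1) = 1 ->
  (forall f, bounded_measurable f -> P (T f) = P f * P (T (fun=> 1))) ->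
  forall f, bounded_measurable f -> P f = pf f.
Proof.
move=> pP P1 PT f bf; set t := P (T _) in PT.
have Pn n g : bounded_measurable g -> P (iter n T g) = P g * t ^+ n.
  move=> bg; elim: n => [|n IH]; first by rewrite expr0 mulr1.
  by rewrite iterS PT ?IH ?exprSr ?mulrA//; exact: bT.
have t0 : 0 < t.
  apply: (@lt_le_trans _ _ 1) => //; rewrite -P1 /t.
  apply: (poslin_le pP) => //; first exact: pT.1.
  by move=> x; rewrite (le_trans (ltW gm1)).
have [B [B0 sB]] := sandwich0_bounded bf.
have C0 : 0 <= (rho ^+ k)^-1 * (B - - B).
  by rewrite mulr_ge0 ?invr_ge0 ?exprn_ge0 ?(ltW rho0)// opprK addr_ge0.
apply/eqP; rewrite -subr_eq0 -normr_le0; apply/ler_addgt0Pr => e e0.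
rewrite add0r; have [n hn] := rho_small e0 C0.
apply: le_trans hn; have tn : 0 < t ^+ n by rewrite exprn_gt0.
have := poslin_iter_pf_dist n pP bf sB; rewrite !Pn// P1 mul1r -mulrBl normrM.
by rewrite (gtr0_norm tn) ler_pM2r// mulrAC.
Qed.

(** * Supercritical flow with births *)

Section perturbed_flow.
Variables (g0 m : (E -> R) -> R) (pg : poslin g0) (pm : poslin m).
Hypothesis g01 : 0 < g0 (fun=> 1).
Hypothesis rt : 1 < rho * theta.

(** Abstract form of [gamma_n (f)], with [T], [g0], [m] in place of [Q], [gamma_0], [mu]; all three
    regimes use it. *)
Definition flow n f := g0 (iter n T f) + \sum_(i < n) m (iter i T f).

Let le_h F c1 c2 n : poslin F ->
  (forall n x, c1 * theta ^+ n <= h n x <= c2 * theta ^+ n) ->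
  F (fun=> 1) * c1 * theta ^+ n <= F (h n) <= F (fun=> 1) * c2 * theta ^+ n.
Proof.
move=> pF hc; rewrite -!mulrA ![F _ * _]mulrC -!(poslin_cst pF).
apply/andP; split; apply: (poslin_le pF); try exact: bounded_measurable_cst.
- exact: bT.
- by move=> x; have /andP[] := hc n x.
- exact: bT.
- by move=> x; have /andP[] := hc n x.
Qed.

(** The initial mass alone gives the lower bound. Since [theta > 1], the births add up to a
    geometric sum of the same order [theta ^+ n]. *)
Lemma flow_mass : exists c1 c2, [/\ 0 < c1, 0 < c2 &
  forall n, c1 * theta ^+ n <= flow n (fun=> 1) <= c2 * theta ^+ n].
Proof.
have [c1 [c2 [c10 c20 hc]]] := h_pf_bounds.
have t1 : 1 < theta := lt_le_trans gm1 pf_gt1.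
have m0 : 0 <= m (fun=> 1) by apply: pm.2.
exists (g0 (fun=> 1) * c1),
  (g0 (fun=> 1) * c2 + m (fun=> 1) * c2 / (theta - 1)); split.
- by rewrite mulr_gt0.
- by rewrite ltr_pwDl ?mulr_gt0// divr_ge0 ?subr_ge0 ?(ltW t1)// mulr_ge0// ltW.
move=> n; have /andP[l r] := le_h n pg hc; apply/andP; split.
  rewrite (le_trans l)// lerDl sumr_ge0// => i _; apply: pm.2; first exact: bT.
  by move=> x; rewrite ltW.
rewrite mulrDl lerD//.
apply: (@le_trans _ _ (\sum_(i < n) m (fun=> 1) * c2 * theta ^+ i)).
  by apply: ler_sum => i _; have /andP[] := le_h i pm hc.
rewrite -mulr_sumr -[leRHS]mulrA ler_wpM2l ?mulr_ge0 ?(ltW c20)// mulrC.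
exact: geometric_sum_le.
Qed.

Lemma flow_dist : exists c, forall n f a A, bounded_measurable f ->
  sandwich 0 f a A ->
  `|flow n f / flow n (fun=> 1) - pf f| <= c * (A - a) * rho ^+ n.
Proof.
have [c1 [c2 [c10 c20 hc]]] := h_pf_bounds.
have [d1 [d2 [d10 d20 fd]]] := flow_mass.
have t0 : 0 < theta by rewrite (lt_le_trans _ pf_gt1)// (lt_trans _ gm1).
have m0 : 0 <= m (fun=> 1) by apply: pm.2.
have rk0 : 0 < rho ^+ k by rewrite exprn_gt0.
(* The error at age [i] is of order [(rho * theta) ^+ i]. By [rt] the sum over ages is of the order
   of its last terms, and division by a mass of order [theta ^+ n] leaves [rho ^+ n]. *)
pose K := g0 (fun=> 1) * c2 + m (fun=> 1) * c2 / (rho * theta - 1).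
exists (K * (rho ^+ k)^-1 / d1) => n f a A bf sf.
have Aa : 0 <= A - a by rewrite subr_ge0 (sandwich_le sf).
have /andP[fl _] := fd n; have tn : 0 < theta ^+ n by rewrite exprn_gt0.
have f0 : 0 < flow n (fun=> 1) by rewrite (lt_le_trans _ fl)// mulr_gt0.
pose D := (rho ^+ k)^-1 * (A - a).
have D0 : 0 <= D by rewrite mulr_ge0// invr_ge0 ltW.
have S F i : poslin F -> `|F (iter i T f) - pf f * F (h i)| <=
    D * (F (fun=> 1) * c2 * (rho * theta) ^+ i).
  move=> pF; apply: (le_trans (poslin_iter_pf_dist i pF bf sf)).
  have /andP[_ r] := le_h i pF hc.
  apply: (@le_trans _ _ (D * rho ^+ i * (F (fun=> 1) * c2 * theta ^+ i))).
    by rewrite /D [_ * _ * (A - a)]mulrAC ler_wpM2l// mulr_ge0// exprn_ge0// ltW.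
  by rewrite exprMn le_eqVlt; apply/orP; left; apply/eqP; ring.
have -> : flow n f / flow n (fun=> 1) - pf f =
    (flow n f - pf f * flow n (fun=> 1)) / flow n (fun=> 1).
  by rewrite mulrBl mulfK// gt_eqF.
rewrite normrM normfV (gtr0_norm f0) ler_pdivrMr//.
apply: (@le_trans _ _ (D * (K * (rho * theta) ^+ n))); last first.
  apply: (@le_trans _ _ (K * (rho ^+ k)^-1 / d1 * (A - a) * rho ^+ n *
                        (d1 * theta ^+ n))).
    rewrite le_eqVlt; apply/orP; left; apply/eqP.
    by rewrite /D exprMn; field; rewrite !gt_eqF.
  rewrite ler_wpM2l// !mulr_ge0 ?exprn_ge0 ?invr_ge0 ?(ltW rho0) ?(ltW rk0) ?(ltW d10)//.
  rewrite /K addr_ge0 ?divr_ge0 ?mulr_ge0 ?(ltW c20) ?(ltW g01)//.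
  by rewrite subr_ge0 ltW.
rewrite /flow mulrDr opprD addrACA mulr_sumr -sumrB.
rewrite (le_trans (ler_normD _ _))// [K * _]mulrDl mulrDr lerD ?S//.
apply: le_trans (ler_norm_sum _ _ _) _.
apply: (@le_trans _ _
  (\sum_(i < n) D * (m (fun=> 1) * c2 * (rho * theta) ^+ i))).
  by apply: ler_sum => i _; exact: S.
rewrite -mulr_sumr ler_wpM2l// -mulr_sumr -[leRHS]mulrA ler_wpM2l ?mulr_ge0 ?(ltW c20)//.
rewrite [leRHS]mulrC; exact: geometric_sum_le.
Qed.

End perturbed_flow.
End decay.
End perron_frobenius.

(** * Total variation and the conservative and subcritical flows *)

Section total_variation.
Context d (E : measurableType d) (R : realType).
Implicit Types (f : E -> R) (m : {measure set E -> \bar R}).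

Definition osc1 f := bounded_measurable f /\ forall x y, `|f x - f y| <= 1.

(** Oscillation at most 1 confines the values to distance 1 from [f point], so the test functions of
    [tvdist] are bounded. *)
Lemma osc1P f : osc1 f <-> measurable_fun [set: E] f /\ (osc f <= 1)%E.
Proof.
split=> [[[mf _] h]|[mf h]].
  by split=> //; apply: ge_ereal_sup => _ [x _ [y _ <-]]; rewrite lee_fin.
have fxy x y : `|f x - f y| <= 1.
  rewrite -lee_fin; apply: le_trans h; apply: ereal_sup_ubound.
  by exists x => //; exists y.
split=> //; apply/bounded_measurableP; split=> //.
exists (1 + `|f point|) => x; rewrite -lerBlDr.
exact: le_trans (lerB_dist _ _) (fxy _ _).
Qed.

Lemma tvdist_le m1 m2 (c : R) :
  (forall f, osc1 f -> `|\int[m1]_x f x - \int[m2]_x f x| <= c) ->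
  (tvdist m1 m2 <= c%:E)%E.
Proof.
move=> h; apply: ge_ereal_sup => _ [f /osc1P fo <-].
by rewrite lee_fin; exact: h.
Qed.

Lemma le_tvdist m1 m2 f : osc1 f ->
  ((`|\int[m1]_x f x - \int[m2]_x f x|)%:E <= tvdist m1 m2)%E.
Proof. by move=> /osc1P fo; apply: ereal_sup_ubound; exists f. Qed.

End total_variation.

(** * The conservative flow *)

Section conservative_flow.
Context d (E : measurableType d) (R : realType).
Variables (T : (E -> R) -> E -> R) (pT : posop T).
Hypothesis T1 : T (fun=> 1) = fun=> 1.
Variables (eta : (E -> R) -> R).
Hypothesis etaT : forall f, bounded_measurable f -> eta (T f) = eta f.
Variables (b : nat -> R) (B : R).
Hypothesis bP : forall n f x, osc1 f -> `|iter n T f x - eta f| <= b n.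
Hypothesis bB : forall n, \sum_(i < n) b i <= B.

Let Tcst n c : iter n T (fun=> c) = fun=> c.
Proof.
apply/funext => x; rewrite (poslin_cst ((posop_iter n pT).2 x)).
by elim: n x => [|n IH] x; rewrite ?mulr1// iterSr T1.
Qed.

(** [T] fixes constants, so averaging [f <= f z + 1] at [x] gives [T^n f x - 1 <= f z] for every
    [z]; averaging this in [z] at [y] concludes. *)
Lemma osc1_iter n f : osc1 f -> osc1 (iter n T f).
Proof.
move=> [bf fo]; have [bT pTx] := posop_iter n pT; split; first exact: bT.
suff H x y : iter n T f x - iter n T f y <= 1.
  by move=> x y; rewrite ler_norml H andbT lerNl opprB H.
have bc c : bounded_measurable (fun _ : E => c : R).
  exact: bounded_measurable_cst.
have fx z : iter n T f x - 1 <= f z.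
  rewrite lerBlDr -[leRHS](congr1 (@^~ x) (Tcst n (f z + 1))).
  apply: (poslin_le (pTx x)) => // w; rewrite -lerBlDl.
  exact: le_trans (ler_norm _) (fo _ _).
rewrite lerBlDl -lerBlDr -[leLHS](congr1 (@^~ y) (Tcst n _)).
exact: (poslin_le (pTx y)).
Qed.

(** For each [i <= n], applying the [i]-th bound to [T^(n - i) f], which has the same [eta]-value,
    bounds the same distance by [b i]. Summing over the [n.+1] values of [i] gives the factor. *)
Lemma iter_dist_le n f x : osc1 f -> n.+1%:R * `|iter n T f x - eta f| <= B.
Proof.
move=> fo; have bf := fo.1; apply: le_trans (bB n.+1).
rewrite mulr_natl -[X in _ *+ X]card_ord -sumr_const.
apply: ler_sum => i _; have ni : (i <= n)%N by rewrite -ltnS.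
have etan j : eta (iter j T f) = eta f.
  by elim: j => // j IH; rewrite iterS etaT//; apply: (posop_iter j pT).1.
rewrite -[in X in X - _](subnKC ni) iterD -(etan (n - i)%N).
by apply: bP; exact: osc1_iter.
Qed.

Variables (g0 m : (E -> R) -> R) (pg : poslin g0) (pm : poslin m).

Lemma flow_cst1 n : flow T g0 m n (fun=> 1) = g0 (fun=> 1) + n%:R * m (fun=> 1).
Proof.
rewrite /flow Tcst; congr +%R.
under eq_bigr do rewrite Tcst.
by rewrite sumr_const card_ord mulr_natl.
Qed.

(** Births of all ages contribute at most [m 1 * B], uniformly in [n]. The decay [B / n.+1] of the
    initial term matters when [m 1 = 0], for then the total mass does not grow. *)
Lemma conservative_flow_dist n f : osc1 f ->
  `|flow T g0 m n f - flow T g0 m n (fun=> 1) * eta f| <=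
  g0 (fun=> 1) * (B / n.+1%:R) + m (fun=> 1) * B.
Proof.
move=> fo; have bf := fo.1.
have bT i : bounded_measurable (iter i T f) by exact: (posop_iter i pT).1.
have b1 := bounded_measurable_cst E.
have D F i c : poslin F -> (forall x, `|iter i T f x - eta f| <= c) ->
    `|F (iter i T f) - F (fun=> 1) * eta f| <= F (fun=> 1) * c.
  move=> pF h; rewrite ![F (fun=> 1) * _]mulrC -!(poslin_cst pF) -(poslinB pF)//.
  by apply: (poslin_norm_le pF) => //; exact: bounded_measurableB.
rewrite flow_cst1 mulrDl /flow opprD addrACA.
apply: le_trans (ler_normD _ _) _; apply: lerD.
  by apply: D => // x; rewrite ler_pdivlMr// mulrC; exact: iter_dist_le.
have -> : n%:R * m (fun=> 1) * eta f = \sum_(i < n) m (fun=> 1) * eta f.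
  by rewrite sumr_const card_ord -mulrA mulr_natl.
rewrite -sumrB; apply: le_trans (ler_norm_sum _ _ _) _.
apply: (@le_trans _ _ (\sum_(i < n) m (fun=> 1) * b i)).
  by apply: ler_sum => i _; apply: D => // x; exact: bP.
by rewrite -mulr_sumr ler_wpM2l// pm.2.
Qed.

End conservative_flow.

(** * The subcritical flow *)

Section subcritical_flow.
Context d (E : measurableType d) (R : realType).
Variables (T : (E -> R) -> E -> R) (pT : posop T) (q : R).
Hypotheses (q0 : 0 < q) (q1 : q < 1) (Tq : forall x, T (fun=> 1) x <= q).
Variables (g0 m : (E -> R) -> R) (pg : poslin g0) (pm : poslin m).
Hypotheses (g01 : 0 < g0 (fun=> 1)) (m1 : 0 < m (fun=> 1)).

Let b1 : bounded_measurable (fun _ : E => 1 : R).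
Proof. exact: bounded_measurable_cst. Qed.

Let bT n f : bounded_measurable f -> bounded_measurable (iter n T f).
Proof. exact: (posop_iter n pT).1. Qed.

Let pTn n x : poslin (fun f => iter n T f x).
Proof. exact: (posop_iter n pT).2. Qed.

Lemma iter_norm_le n f U x : bounded_measurable f -> (forall x, `|f x| <= U) ->
  `|iter n T f x| <= U * iter n T (fun=> 1) x.
Proof.
move=> bf fU; rewrite -(poslin_cst (pTn n x)).
by apply: (poslin_norm_le (pTn n x)) => //; exact: bounded_measurable_cst.
Qed.

Lemma iter1_le n x : iter n T (fun=> 1) x <= q ^+ n.
Proof.
elim: n x => [|n IH] x; first by rewrite expr0.
rewrite iterS exprSr; apply: (@le_trans _ _ (q ^+ n * T (fun=> 1) x)).
  rewrite -(poslin_cst (pT.2 x)); apply: (poslin_le (pT.2 x)) => //.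
    exact: bT.
  exact: bounded_measurable_cst.
by rewrite ler_wpM2l// exprn_ge0// ltW.
Qed.

Definition term f n := m (iter n T f).

Section bounded_by.
Variables (f : E -> R) (U : R) (bf : bounded_measurable f).
Hypothesis fU : forall x, `|f x| <= U.

Let U0 : 0 <= U. Proof. exact: le_trans (fU point). Qed.

Lemma poslin_iter_norm_le F n : poslin F ->
  `|F (iter n T f)| <= F (fun=> 1) * U * q ^+ n.
Proof.
move=> pF; rewrite -mulrA mulrC -(poslin_cst pF).
apply: (poslin_norm_le pF); [exact: bT|exact: bounded_measurable_cst|move=> x].
by rewrite (le_trans (iter_norm_le _ _ bf fU))// ler_wpM2l// iter1_le.
Qed.

Lemma sum_geometric_range n N : (n <= N)%N ->
  \sum_(n <= i < N) q ^+ i <= q ^+ n / (1 - q).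
Proof.
have q1' : 0 < 1 - q by rewrite subr_gt0.
move=> nN; rewrite -[X in \sum_(X <= _ < _) _]add0n big_addn big_mkord.
under eq_bigr do rewrite exprD.
rewrite -mulr_suml mulrC ler_wpM2l ?exprn_ge0 ?(ltW q0)//.
rewrite -div1r ler_pdivlMr// mulrC -opprB mulNr -subrX1 opprB.
by rewrite gerBl exprn_ge0// ltW.
Qed.

Lemma series_term_dist n N : (n <= N)%N ->
  `|series (term f) N - series (term f) n| <=
    m (fun=> 1) * U / (1 - q) * q ^+ n.
Proof.
move=> nN; rewrite sub_series_geq//.
apply: le_trans (ler_norm_sum _ _ _) _.
apply: (@le_trans _ _ (\sum_(n <= i < N) m (fun=> 1) * U * q ^+ i)).
  by apply: ler_sum => i _; exact: poslin_iter_norm_le.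
rewrite -mulr_sumr -[leRHS]mulrA [_^-1 * _]mulrC ler_wpM2l ?sum_geometric_range//.
by rewrite mulr_ge0// ltW.
Qed.

Lemma series_term_cvg : cvgn (series (term f)).
Proof.
apply: normed_cvg; apply: (@series_le_cvg _ _ (geometric (m (fun=> 1) * U) q)).
- by move=> n /=; exact: normr_ge0.
- by move=> n /=; rewrite !mulr_ge0 ?exprn_ge0 ?(ltW q0) ?(ltW m1).
- by move=> n /=; exact: poslin_iter_norm_le.
- by apply: is_cvg_geometric_series; rewrite gtr0_norm.
Qed.

Lemma lim_series_term_dist n :
  `|series (term f) n - limn (series (term f))| <=
    m (fun=> 1) * U / (1 - q) * q ^+ n.
Proof.
rewrite distrC; apply: (@cvgr_to_le nat \oo _ R
  (fun N => `|series (term f) N - series (term f) n|)).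
  apply: cvg_norm; apply: cvgB; last exact: cvg_cst.
  exact: series_term_cvg.
by exists n => // N nN; exact: series_term_dist.
Qed.

End bounded_by.

Lemma lim_series_term1_ge : m (fun=> 1) <= limn (series (term (fun=> 1))).
Proof.
apply: limr_ge; first by apply: (series_term_cvg b1 (U := 1)) => x; rewrite normr1.
(* The empty partial sum is 0; from index 1 on, the sums contain the term [m 1]. *)
exists 1%N => // -[//|N] _ /=; rewrite /series/= big_nat_recl//= lerDl.
rewrite sumr_ge0// => i _; apply: pm.2; first exact: bT.
by move=> x; apply: (pTn _ x).2.
Qed.

(** It bounds the normalized limit by [U], the weight of the mass error in the comparison of
    quotients. *)
Lemma lim_series_term_norm_le f U : bounded_measurable f ->
  (forall x, `|f x| <= U) ->
  `|limn (series (term f))| <= U * limn (series (term (fun=> 1))).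
Proof.
move=> bf fU; have c1 : cvgn (series (term (fun=> 1))).
  by apply: (series_term_cvg b1 (U := 1)) => x; rewrite normr1.
have cf := series_term_cvg bf fU.
apply: (ler_cvg_to (cvg_norm cf) (cvgMl_tmp (a := U) c1)).
apply: nearW => n; rewrite /series/= mulr_sumr.
apply: le_trans (ler_norm_sum _ _ _) _; apply: ler_sum => i _.
rewrite -(poslinZ pm); last exact: bT.
apply: (poslin_norm_le pm) => [||x]; [exact: bT| |exact: iter_norm_le].
by apply: bounded_measurableZ; exact: bT.
Qed.

(** At time 0 the mass is [g0 1]; at later times it is at least that of the newest births, [m 1].
    Normalization thus costs only a constant factor. *)
Lemma subcritical_flow_ge : exists a, 0 < a /\
  forall n, a <= flow T g0 m n (fun=> 1).
Proof.
exists (Num.min (g0 (fun=> 1)) (m (fun=> 1))); split; first by rewrite lt_min g01.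
have mi i : 0 <= m (iter i T (fun=> 1)).
  by apply: pm.2 => [|x]; [exact: bT|exact: (pTn _ x).2].
case=> [|n]; rewrite /flow; first by rewrite big_ord0 addr0 ge_min lexx.
rewrite big_ord_recl/= ge_min; apply/orP; right.
rewrite addrCA lerDl addr_ge0//; last by apply: sumr_ge0 => i _; exact: (mi i.+1).
by apply: pg.2 => [|x]; [exact: (bT n.+1)|exact: (pTn n.+1 x).2].
Qed.

Lemma subcritical_flow_gt0 n : 0 < flow T g0 m n (fun=> 1).
Proof. by have [a [a0 ma]] := subcritical_flow_ge; exact: lt_le_trans (ma n). Qed.

Lemma subcritical_flow_dist : exists c, forall n f U, bounded_measurable f ->
  (forall x, `|f x| <= U) ->
  `|flow T g0 m n f - limn (series (term f))| <= c * q ^+ n * U /\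
  `|flow T g0 m n f / flow T g0 m n (fun=> 1) -
    limn (series (term f)) / limn (series (term (fun=> 1)))| <= c * q ^+ n * U.
Proof.
pose C := g0 (fun=> 1) + m (fun=> 1) / (1 - q).
have q1' : 0 < 1 - q by rewrite subr_gt0.
have C0 : 0 < C by rewrite addr_gt0// divr_gt0.
have [a [a0 ma]] := subcritical_flow_ge.
(* [C] serves the flow itself; [2 / a] accounts for the errors of numerator and mass, divided by a
   mass of at least [a]. *)
exists (C * (1 + 2 / a)) => n f U bf fU.
have U0 : 0 <= U := le_trans (normr_ge0 _) (fU point).
have qn : 0 < q ^+ n by rewrite exprn_gt0.
have D f' U' : bounded_measurable f' -> (forall x, `|f' x| <= U') ->
    `|flow T g0 m n f' - limn (series (term f'))| <= C * q ^+ n * U'.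
  move=> bf' fU'; rewrite /flow -addrA.
  apply: le_trans (ler_normD _ _) _.
  have := lim_series_term_dist bf' fU' n.
  rewrite /series/= big_mkord => h1.
  have h2 := poslin_iter_norm_le bf' fU' n pg.
  apply: le_trans (lerD h2 h1) _; rewrite le_eqVlt; apply/orP; left; apply/eqP.
  by rewrite /C; field; rewrite gt_eqF.
split.
  apply: le_trans (D _ _ bf fU) _; rewrite -!mulrA ler_wpM2l ?(ltW C0)//.
  rewrite ler_peMl ?mulr_ge0 ?(ltW qn)// lerDl divr_ge0// ltW//.
set l := limn (series (term f)); set l1 := limn (series (term (fun=> 1))).
have l10 : 0 < l1 := lt_le_trans m1 lim_series_term1_ge.
have D1 : `|flow T g0 m n (fun=> 1) - l1| <= C * q ^+ n * 1.
  by apply: D => // x; rewrite normr1.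
have Df := D _ _ bf fU; rewrite -/l in Df.
have l_le : `|l| <= U * l1 := lim_series_term_norm_le bf fU.
set F1 := flow T g0 m n (fun=> 1) in D1 *; set F := flow T g0 m n f in Df *.
have F10 : 0 < F1 := lt_le_trans a0 (ma n).
have -> : F / F1 - l / l1 = ((F - l) + l / l1 * (l1 - F1)) / F1.
  by field; rewrite !gt_eqF.
rewrite normrM normfV (gtr0_norm F10) ler_pdivrMr//.
apply: (@le_trans _ _ (C * q ^+ n * U + U * (C * q ^+ n * 1))).
  apply: le_trans (ler_normD _ _) _; apply: lerD => //.
  rewrite normrM distrC; apply: ler_pM => //.
  by rewrite normrM normfV (gtr0_norm l10) ler_pdivrMr.
apply: (@le_trans _ _ (C * (1 + 2 / a) * q ^+ n * U * a)).
  have -> : C * (1 + 2 / a) * q ^+ n * U * a = C * q ^+ n * U * a +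
    (C * q ^+ n * U + U * (C * q ^+ n * 1)) by field; rewrite gt_eqF.
  by rewrite lerDr !mulr_ge0// ltW.
rewrite ler_wpM2l ?ma// !mulr_ge0 ?(ltW C0) ?(ltW qn)//.
by rewrite addr_ge0// divr_ge0// ltW.
Qed.

End subcritical_flow.

(** * Normalized measures and the map [Phi] *)

Section normalization.
Context d (E : measurableType d) (R : realType).

Lemma probability_setT_fin (P : probability E R) : (P [set: E] < +oo)%E.
Proof. by rewrite probability_setT ltry. Qed.

Lemma probability_Rintegral (P : probability E R) A : measurable A ->
  P A = (\int[P]_x \1_A x)%:E.
Proof.
move=> mA; rewrite Rintegral_indic_setT// fineK//; apply: le_measureT_fin_num => //.
exact: probability_setT_fin.
Qed.

Lemma poslin_probability (P : probability E R) :
  poslin (fun f => \int[P]_x f x).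
Proof. by apply: poslin_int; exact: probability_setT_fin. Qed.

Lemma Rintegral1_probability (P : probability E R) : \int[P]_x 1 = 1.
Proof. by rewrite Rintegral1 [X in fine X]probability_setT. Qed.

Lemma Rintegral1_gt0 (nu : {measure set E -> \bar R}) :
  (nu [set: E] < +oo)%E -> (0 < nu [set: E])%E = (0 < \int[nu]_x 1).
Proof.
by move=> nuoo; rewrite Rintegral1 -lte_fin fineK// le_measureT_fin_num.
Qed.

Variables (Q : R.-ker E ~> E) (C : R) (QC : mass_le Q C).

Lemma Rintegral_Phi (P : probability E R) f : 0 < \int[P]_x kop Q (fun=> 1) x ->
  bounded_measurable f ->
  \int[Phi Q P]_x f x =
    (\int[P]_x kop Q f x) / (\int[P]_x kop Q (fun=> 1) x).
Proof.
move=> P0 bf; have Poo := probability_setT_fin P.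
have moo := mact_fin QC Poo.
have b1 := bounded_measurable_cst E (1 : R).
rewrite -!(Rintegral_mact QC)// Rintegral_mnormalize//.
by rewrite Rintegral1_gt0// (Rintegral_mact QC).
Qed.

Variables (mu gamma0 : {measure set E -> \bar R}).
Hypothesis muoo : (mu [set: E] < +oo)%E.
Hypothesis gamma0oo : (gamma0 [set: E] < +oo)%E.

Local Notation flowQ := (flow (kop Q)
  (fun f => \int[gamma0]_x f x) (fun f => \int[mu]_x f x)).

Lemma Rintegral_gamma_seq_flow n f : bounded_measurable f ->
  \int[gamma_seq Q mu gamma0 n]_x f x = flowQ n f.
Proof. exact: (Rintegral_gamma_seq QC muoo gamma0oo). Qed.

Lemma Rintegral_eta_seq n f : 0 < flowQ n (fun=> 1) -> bounded_measurable f ->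
  \int[eta_seq Q mu gamma0 n]_x f x = flowQ n f / flowQ n (fun=> 1).
Proof.
move=> f0 bf; have goo := gamma_seq_fin QC muoo gamma0oo n.
have b1 := bounded_measurable_cst E (1 : R).
rewrite -!Rintegral_gamma_seq_flow// Rintegral_mnormalize//.
by rewrite Rintegral1_gt0// Rintegral_gamma_seq_flow.
Qed.

End normalization.

(** * Kernels weighted by a potential *)

Section potential.
Context d (E : measurableType d) (R : realType).
Variables (G : E -> R) (mG : measurable_fun [set: E] G).
Variables (G0 : forall x, 0 < G x) (M : R.-pker E ~> E).

Local Notation Q := (kpotential G0 M mG : R.-ker E ~> E).

Lemma mass_le_pker : mass_le M 1.
Proof. by move=> x; rewrite prob_kernel. Qed.

Lemma kpotentialE x A : Q x A = ((G x)%:E * M x A)%E.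
Proof. by []. Qed.

Lemma mass_le_kpotential C : (forall x, G x <= C) -> mass_le Q C.
Proof. by move=> GC x; rewrite kpotentialE prob_kernel mule1 lee_fin. Qed.

Lemma kop_pker1 : kop M (fun=> 1) = fun=> 1.
Proof. by apply/funext => x; rewrite /kop Rintegral1 prob_kernel. Qed.

Lemma kop_kpotential f x : bounded_measurable f ->
  kop Q f x = G x * kop M f x.
Proof.
have Moo : (M x [set: E] < +oo)%E by rewrite prob_kernel ltry.
move: f; apply: poslin_eq_indic.
- by apply: poslin_int; rewrite kpotentialE prob_kernel mule1 ltry.
- split=> [a f g bf bg|f bf f0].
    by rewrite /kop (poslin_int Moo).1//; ring.
  by rewrite mulr_ge0 ?(ltW (G0 x))//; exact: (poslin_int Moo).2.
move=> A mA; rewrite /kop !Rintegral_indic_setT// kpotentialE.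
by rewrite -(@fineK _ (M x A)) ?le_measureT_fin_num.
Qed.

Lemma kop_kpotential1 : kop Q (fun=> 1) = G.
Proof.
apply/funext => x; rewrite kop_kpotential; last exact: bounded_measurable_cst.
by rewrite kop_pker1 mulr1.
Qed.

(** On nonnegative functions [Q^k] lies between [gm ^+ k * M^k] and [gp ^+ k * M^k], so the
    minorization of [M^k] passes to [Q^k] at the cost of [(gm / gp) ^+ k]. *)
Lemma kpotential_minor (k : nat) (eps gm gp : R) : 0 < gm ->
  (forall x, gm <= G x <= gp) -> 0 < eps ->
  (forall x y A, measurable A -> (eps%:E * kpow M k y A <= kpow M k x A)%E) ->
  forall u, bounded_measurable u -> (forall x, 0 <= u x) ->
  forall x y, (gm / gp) ^+ k * eps * iter k (kop Q) u y <= iter k (kop Q) u x.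
Proof.
move=> gm0 Gb e0 H u bu u0 x y.
have gp0 : 0 < gp by have /andP[h1 h2] := Gb x; rewrite (lt_le_trans gm0)// (le_trans h1).
have pM := posop_kop mass_le_pker.
have pQ := posop_kop (@mass_le_kpotential gp (fun x => (andP (Gb x)).2)).
have Mm n z : 0 <= iter n (kop M) u z by apply: ((posop_iter n pM).2 z).2.
have QM n : forall z, gm ^+ n * iter n (kop M) u z <= iter n (kop Q) u z
    <= gp ^+ n * iter n (kop M) u z.
  elim: n => [|n IH] z; first by rewrite !expr0 !mul1r lexx.
  have bMn : bounded_measurable (iter n (kop M) u) by exact: (posop_iter n pM).1.
  have bQn : bounded_measurable (iter n (kop Q) u) by exact: (posop_iter n pQ).1.
  have bZ a : bounded_measurable (fun x => a * iter n (kop M) u x).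
    exact: bounded_measurableZ.
  have /andP[g1 g2] := Gb z.
  rewrite iterS [iter n.+1 (kop Q) _]iterS kop_kpotential// !exprS -!mulrA.
  have := poslin_le (pM.2 z) (bZ (gm ^+ n)) bQn (fun w => (andP (IH w)).1).
  have := poslin_le (pM.2 z) bQn (bZ (gp ^+ n)) (fun w => (andP (IH w)).2).
  rewrite !(poslinZ (pM.2 z))// => h2 h1.
  have M0 : 0 <= kop M (iter n (kop M) u) z := Mm n.+1 z.
  by apply/andP; split; apply: ler_pM; rewrite ?mulr_ge0 ?exprn_ge0 ?(ltW gm0) ?(ltW (G0 z))//;
    apply: le_trans h1; rewrite mulr_ge0// exprn_ge0// ltW.
have Mk w : (kpow M k w [set: E] < +oo)%E.
  exact: le_lt_trans (mass_le_kpow k mass_le_pker w) (ltry _).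
have EM : eps * iter k (kop M) u y <= iter k (kop M) u x.
  rewrite -!(kop_kpow k mass_le_pker bu).
  have pe : poslin (fun f => eps * \int[kpow M k y]_z f z).
    split=> [a f g bf bg|f bf f0]; last by rewrite mulr_ge0 ?(ltW e0)// (poslin_int (Mk y)).2.
    by rewrite (poslin_int (Mk y)).1//; ring.
  apply: (poslin_le_indic pe (poslin_int (Mk x))) => // A mA.
  rewrite !Rintegral_indic_setT// -lee_fin EFinM !fineK ?le_measureT_fin_num//.
  exact: H.
have /andP[_ Qy] := QM k y; have /andP[Qx _] := QM k x.
apply: le_trans Qx; apply: (@le_trans _ _ (gm ^+ k * (eps * iter k (kop M) u y))); last first.
  by rewrite ler_wpM2l// exprn_ge0// ltW.
rewrite expr_div_n -!mulrA ler_wpM2l ?exprn_ge0 ?(ltW gm0)//.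
rewrite mulrCA ler_wpM2l ?(ltW e0)// mulrC ler_pdivrMr ?exprn_gt0//.
by rewrite mulrC.
Qed.

End potential.

(** * The three regimes of the branching flow *)

Theorem theorem3p1 (R : realType) (d : measure_display) (E : measurableType d)
  (G : E -> R) (mG : measurable_fun [set: E] G) (G0 : forall x, 0 < G x)
  (M : R.-pker E ~> E) (mu gamma0 : {finite_measure set E -> \bar R})
  (gamma0_gt0 : (0 < gamma0 [set: E])%E)
  (gm_gt0 : 0 < inf (range G)) (gp_fin : has_ubound (range G)) :
  let Q : R.-ker E ~> E := kpotential G0 M mG in
  let gp := sup (range G) in
  let gamma_ := gamma_seq Q mu gamma0 in
  let eta_ := eta_seq Q mu gamma0 in
  [/\ (forall x, G x = 1) ->
      (forall n : nat, gamma_ n [set: E] =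
         gamma0 [set: E] + mu [set: E] * (n%:R)%:E)%E /\
      (forall eta_inf : probability E R,
         measure_eq eta_inf (mact eta_inf M) ->
         (\sum_(0 <= n <oo)
            ereal_sup (range (fun x => tvdist (kpow M n x) eta_inf))
            < +oo)%E ->
         exists c : R,
           \forall n \near \oo, (tvdist (eta_ n) eta_inf <= (c / n%:R)%:E)%E),
      gp < 1 -> (0 < mu [set: E])%E ->
      (forall f : E -> R, bounded_measurable f ->
         cvgn (series (gamma_term Q mu f))) /\
      exists c : R, forall (n : nat) (f : E -> R), bounded_measurable f ->
        Num.max `|\int[gamma_ n]_x f x - gamma_oo Q mu f|
                `|\int[eta_ n]_x f x - eta_oo Q mu f|
        <= c * gp ^+ n * unorm f
    & 1 < inf (range G) ->
      (exists (k : nat) (eps : R), [/\ (1 <= k)%N, 0 < eps &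
         forall (x y : E) (A : set E), measurable A ->
           (eps%:E * kpow M k y A <= kpow M k x A)%E]) ->
      exists eta_inf : probability E R,
        [/\ measure_eq eta_inf (Phi Q eta_inf),
            forall eta' : probability E R,
              measure_eq eta' (Phi Q eta') -> measure_eq eta' eta_inf,
            (fun n : nat => n%:R^-1 * ln (fine (gamma_ n [set: E]))) @ \oo
              --> ln (\int[eta_inf]_x G x)
          & exists c lambda : R, 0 < lambda /\
              forall n : nat,
                (tvdist (eta_ n) eta_inf <= (c * expR (- lambda * n%:R))%:E)%E]].
Proof.
move=> Q gp gamma_ eta_.
have muoo : (mu [set: E] < +oo)%E by rewrite -ge0_fin_numE// fin_num_measure.
have g0oo : (gamma0 [set: E] < +oo)%E by rewrite -ge0_fin_numE// fin_num_measure.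
have Ggp x : G x <= gp by apply: ub_le_sup => //; exists x.
have Ggm x : inf (range G) <= G x.
  apply: ge_inf; last by exists x.
  by exists 0 => _ [y _ <-]; exact: ltW.
have QC : mass_le Q gp by exact: mass_le_kpotential.
have pQ := posop_kop QC.
have pmu := poslin_int muoo; have pg0 := poslin_int g0oo.
have b1 := bounded_measurable_cst E (1 : R).
have T1 : kop Q (fun=> 1) = G by exact: kop_kpotential1.
have g01 : 0 < \int[gamma0]_x 1 by rewrite -Rintegral1_gt0.
have mu1 : 0 <= \int[mu]_x 1 by apply: pmu.2.
split.
- move=> G1.
  have gE n : (gamma_ n [set: E] =
      gamma0 [set: E] + mu [set: E] * (n%:R)%:E)%E.
    elim: n => [|n IH]; first by rewrite mule0 adde0.
    transitivity (mact (gamma_ n) Q [set: E] + mu [set: E])%E.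
      exact: measure_addE.
    have -> : mact (gamma_ n) Q [set: E] = gamma_ n [set: E].
      rewrite /mact; under eq_integral do rewrite kpotentialE prob_kernel mule1 G1.
      by rewrite integral_cst// mul1e.
    rewrite IH -addeA; congr adde; rewrite -natr1 EFinD.
    by rewrite ge0_muleDr ?lee_fin// mule1.
  split=> // eta etaM sumoo.
  have T1' : kop Q (fun=> 1) = fun=> 1 by rewrite T1; apply/funext.
  have QM f : bounded_measurable f -> kop Q f = kop M f.
    by move=> bf; apply/funext => x; rewrite kop_kpotential// G1 mul1r.
  have etaoo := probability_setT_fin eta.
  have etaT f : bounded_measurable f -> \int[eta]_x kop Q f x = \int[eta]_x f x.
    move=> bf; rewrite [RHS](Rintegral_measure_eq f etaM).
    by rewrite (Rintegral_mact (mass_le_pker M))// QM.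
  have QMn n f : bounded_measurable f -> iter n (kop Q) f = iter n (kop M) f.
    move=> bf; elim: n => // n IH; rewrite !iterS IH QM//.
    exact: (posop_iter n (posop_kop (mass_le_pker M))).1.
  pose s n := ereal_sup (range (fun x => tvdist (kpow M n x) eta)).
  have tv_s n x : (tvdist (kpow M n x) eta <= s n)%E.
    by apply: ereal_sup_ubound; exists x.
  have s0 n : (0 <= s n)%E.
    apply: le_trans (tv_s n point); apply: le_trans (le_tvdist _ _ (f := fun=> 0) _).
      by rewrite lee_fin.
    by split=> [|x y]; [exact: bounded_measurable_cst|rewrite subrr normr0].
  have sfin n : s n \is a fin_num.
    rewrite ge0_fin_numE//; apply: le_lt_trans sumoo.
    apply: le_trans (nneseries_lim_ge n.+1 (fun i _ _ => s0 i)).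
    by rewrite big_nat_recr//= leeDr// sume_ge0.
  pose B := fine (\sum_(0 <= n <oo) s n)%E.
  have bP n f x : osc1 f ->
      `|iter n (kop Q) f x - \int[eta]_x f x| <= fine (s n).
    move=> fo; rewrite (QMn _ _ fo.1) -(kop_kpow n (mass_le_pker M) fo.1).
    rewrite -lee_fin fineK//; apply: le_trans (tv_s n x).
    exact: le_tvdist.
  have bB n : \sum_(i < n) fine (s i) <= B.
    have Bfin : (\sum_(0 <= n <oo) s n)%E \is a fin_num.
      by rewrite ge0_fin_numE ?nneseries_ge0.
    rewrite -lee_fin /B fineK// -sumEFin.
    under eq_bigr do rewrite fineK//.
    rewrite -(big_mkord xpredT s).
    by apply: nneseries_lim_ge.
  have B0 : 0 <= B by have := bB 0%N; rewrite big_ord0.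
  (* [B] works because [g0 1 * (B / n.+1) + mu 1 * B] is at most [B / n] times the mass
     [g0 1 + n * mu 1]. The index starts at 1 since [B / 0] would be 0. *)
  exists B; exists 1%N => // n /= n1; apply: tvdist_le => f fo.
  have n0 : 0 < n%:R :> R by rewrite ltr0n.
  have Fn := flow_cst1 pQ T1' (fun f => \int[gamma0]_x f x)
    (fun f => \int[mu]_x f x) n.
  have Fn0 : 0 < flow (kop Q) (fun f => \int[gamma0]_x f x)
      (fun f => \int[mu]_x f x) n (fun=> 1).
    by rewrite Fn ltr_pwDl// mulr_ge0.
  rewrite (Rintegral_eta_seq QC muoo g0oo Fn0 fo.1).
  have := conservative_flow_dist pQ T1' etaT bP bB pg0 pmu n fo.
  set F := flow _ _ _ n f; set F1 := flow _ _ _ n _ in Fn Fn0 *.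
  move=> h; have -> : F / F1 - \int[eta]_x f x = (F - F1 * \int[eta]_x f x) / F1.
    by field; rewrite gt_eqF.
  rewrite normrM normfV (gtr0_norm Fn0) ler_pdivrMr//; apply: (le_trans h).
  rewrite Fn mulrDr; apply: lerD.
    rewrite mulrC ler_wpM2r ?(ltW g01)// ler_wpM2l// lef_pV2 ?posrE ?ltr0n//.
    by rewrite ler_nat.
  by rewrite mulrA divfK ?gt_eqF// mulrC.
- move=> gp1 mu0.
  have mu10 : 0 < \int[mu]_x 1 by rewrite -Rintegral1_gt0.
  have gp0 : 0 < gp by exact: lt_le_trans (G0 point) (Ggp point).
  have Tq x : kop Q (fun=> 1) x <= gp by rewrite T1.
  have unormP (f : E -> R) : bounded_measurable f -> forall x, `|f x| <= unorm f.
    move=> /bounded_measurableP[_ [B fB]] x; apply: ub_le_sup; last by exists x.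
    by exists B => _ [y _ <-].
  have termE f : bounded_measurable f ->
      gamma_term Q mu f = term (kop Q) (fun f => \int[mu]_x f x) f.
    by move=> bf; apply/funext => n; exact: (gamma_termE QC muoo).
  split=> [f bf|].
    rewrite termE//.
    exact: (series_term_cvg pQ gp0 gp1 Tq pmu mu10 bf (unormP f bf)).
  have [c cP] := subcritical_flow_dist pQ gp0 gp1 Tq pg0 pmu g01 mu10.
  exists c => n f bf.
  have [d1 d2] := cP n f (unorm f) bf (unormP f bf).
  have F0 : 0 < flow (kop Q) (fun f => \int[gamma0]_x f x)
      (fun f => \int[mu]_x f x) n (fun=> 1).
    exact: (subcritical_flow_gt0 pQ pg0 pmu g01 mu10).
  rewrite ge_max /eta_oo /gamma_oo !termE//.
  rewrite (Rintegral_eta_seq QC muoo g0oo F0 bf).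
  by rewrite (Rintegral_gamma_seq_flow QC muoo g0oo)// d1 d2.
move=> gm1 [k [eps [k1 e0 H]]].
set gm := inf (range G) in gm1 Ggm gm_gt0.
have Gb x : gm <= G x <= gp by rewrite Ggm Ggp.
pose del := (gm / gp) ^+ k * eps.
have gp0 : 0 < gp by exact: lt_le_trans (G0 point) (Ggp point).
have del0 : 0 < del by rewrite mulr_gt0 ?exprn_gt0 ?divr_gt0.
have minor : forall u, bounded_measurable u -> (forall x, 0 <= u x) ->
    forall x y, del * iter k (kop Q) u y <= iter k (kop Q) u x.
  exact: (kpotential_minor mG G0 gm_gt0 Gb e0 H).
have gmT x : gm <= kop Q (fun=> 1) x by rewrite T1.
have gpT x : kop Q (fun=> 1) x <= gp by rewrite T1.
have del1 : del <= 1 by exact: (minor_le1 pQ gm1 gmT minor).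
have k0 : 0 < k%:R :> R by rewrite ltr0n.
(* Chosen so that [k * y = del ^+ 2 / 2]: Bernoulli then gives
   [1 - del ^+ 2 / 2 <= (1 - y) ^+ k]. *)
pose y := del ^+ 2 / (2 * k%:R).
have y0 : 0 < y by rewrite /y; apply: divr_gt0; [exact: exprn_gt0|apply: mulr_gt0].
have y1 : y < 1.
  rewrite ltr_pdivrMr ?mulr_gt0// mul1r.
  apply: (@le_lt_trans _ _ 1); first by rewrite exprn_ile1// ltW.
  by rewrite -natrM ltr1n mul2n -addnn; case: (k) k1 => // j _; rewrite addnS.
(* The first entry secures the contraction over [k] steps. The second, midway between [gm^-1] and 1,
   secures [rho * theta > 1] because [gm <= theta]. *)
pose rho := Num.max (1 - y) ((1 + gm^-1) / 2).
have gmi1 : gm^-1 < 1 by rewrite invf_lt1.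
have gmi0 : 0 < gm^-1 by rewrite invr_gt0.
have rho0 : 0 < rho by rewrite lt_max; apply/orP; left; rewrite subr_gt0.
have rho1 : rho < 1 by rewrite gt_max; apply/andP; split; lra.
have rhok : 1 - del ^+ 2 / 2 <= rho ^+ k.
  apply: (@le_trans _ _ ((1 - y) ^+ k)).
    apply: le_trans (bernoulli_subr _ _); last by rewrite !ltW.
    have -> : k%:R * y = del ^+ 2 / 2 by rewrite /y; field; rewrite gt_eqF.
    by [].
  apply: lerXn2r; rewrite ?nnegrE ?(ltW rho0)//; first by rewrite subr_ge0 ltW.
  by rewrite le_max lexx.
pose L := pf (kop Q).
have pL : poslin L := poslin_pf pQ k1 del0 gm1 gmT minor rho0 rho1 rhok.
have L1 : L (fun=> 1) = 1 := pf1 pQ k1 del0 gm1 gmT minor rho0 rho1 rhok.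
have gmL : gm <= L (kop Q (fun=> 1)) :=
  pf_gt1 pQ k1 del0 gm1 gmT minor rho0 rho1 rhok.
have rt : 1 < rho * L (kop Q (fun=> 1)).
  apply: (@lt_le_trans _ _ (rho * gm)); last by rewrite ler_wpM2l// ltW.
  rewrite -ltr_pdivrMr// div1r lt_max; apply/orP; right; lra.
have Qkoo : (kpow Q k point [set: E] < +oo)%E.
  exact: le_lt_trans (mass_le_kpow k QC point) (ltry _).
have Ldom f : bounded_measurable f -> (forall x, 0 <= f x) ->
    L f <= del^-1 * \int[kpow Q k point]_x f x.
  move=> bf f0.
  have := pf_dominated pQ k1 del0 gm1 gmT minor rho0 rho1 rhok bf f0.
  by rewrite -(kop_kpow k QC bf).
have di0 : 0 <= del^-1 by rewrite invr_ge0 ltW.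
have [eta etaL] := dominated_poslin_probability pL Qkoo di0 Ldom L1.
have LT f : bounded_measurable f -> L (kop Q f) = L f * L (kop Q (fun=> 1)).
  exact: (pf_op pQ k1 del0 gm1 gmT minor rho0 rho1 rhok).
have bkQ f : bounded_measurable f -> bounded_measurable (kop Q f) := pQ.1 f.
have L0 : 0 < L (kop Q (fun=> 1)) by exact: lt_le_trans gm_gt0 gmL.
have etaA A : measurable A -> eta A = (L \1_A)%:E.
  move=> mA; rewrite probability_Rintegral// etaL//.
  exact: bounded_measurable_indic.
have [c1 [c2 [c10 c20 cb]]] :=
  flow_mass pQ k1 del0 gm1 gmT gpT minor rho0 rho1 rhok pg0 pmu g01.
have F0 n : 0 < flow (kop Q) (fun f => \int[gamma0]_x f x)
    (fun f => \int[mu]_x f x) n (fun=> 1).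
  have /andP[+ _] := cb n; apply: lt_le_trans.
  by rewrite mulr_gt0// exprn_gt0.
exists eta; split.
- have e1 : \int[eta]_x kop Q (fun=> 1) x = L (kop Q (fun=> 1)).
    by apply: etaL; exact: bkQ.
  move=> A mA; have bA := bounded_measurable_indic R mA.
  apply: (eq_trans (etaA A mA)).
  apply: (eq_trans _ (esym (probability_Rintegral (Phi Q eta) mA))); congr EFin.
  have e0' : 0 < \int[eta]_x kop Q (fun=> 1) x by rewrite e1.
  apply: (eq_trans _ (esym (Rintegral_Phi QC e0' bA))).
  rewrite e1 (etaL _ (bkQ _ bA)) (LT _ bA) mulfK//.
  by rewrite gt_eqF.
- move=> eta' eta'P A mA; apply: (eq_trans (probability_Rintegral eta' mA)).
  apply: (eq_trans _ (esym (etaA A mA))); congr EFin.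
  have peta' := poslin_probability eta'.
  (* Positivity excludes the default branch in [Phi], so the fixed point equation becomes the
     multiplicative identity required by [pf_unique]. *)
  have e1 : 0 < \int[eta']_x kop Q (fun=> 1) x.
    apply: (@lt_le_trans _ _ gm) => //.
    have := poslin_cst peta' gm; rewrite Rintegral1_probability mulr1 => <-.
    apply: (poslin_le peta') => //; first exact: bounded_measurable_cst.
    exact: bkQ.
  apply: (pf_unique pQ k1 del0 gm1 gmT minor rho0 rho1 rhok peta').
  + exact: Rintegral1_probability.
  + move=> f bf; rewrite [in RHS](Rintegral_measure_eq f eta'P).
    by rewrite (Rintegral_Phi QC)// divfK// gt_eqF.
  + exact: bounded_measurable_indic.
- have -> : \int[eta]_x G x = L (kop Q (fun=> 1)).
    by rewrite -etaL; [rewrite T1|exact: bkQ].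
  apply: cvg_ln_div_geometric c10 L0 _ => n.
  rewrite -Rintegral1 (Rintegral_gamma_seq_flow QC muoo g0oo)//; exact: cb.
have [c cP] :=
  flow_dist pQ k1 del0 gm1 gmT gpT minor rho0 rho1 rhok pg0 pmu g01 rt.
(* The factor 2 is the length of the interval around [f point] that contains a function of
   oscillation at most 1; [lambda] is read off from [expR (ln rho * n) = rho ^+ n]. *)
exists (c * 2), (- ln rho); split; first by rewrite oppr_gt0 ln_lt0// rho0.
move=> n; apply: tvdist_le => f fo; have bf := fo.1.
rewrite etaL// (Rintegral_eta_seq QC muoo g0oo (F0 n) bf).
have -> : expR (- - ln rho * n%:R) = rho ^+ n.
  by rewrite opprK mulrC expRM_natl lnK.
have sf : sandwich (kop Q) 0 f (f point - 1) (f point + 1).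
  move=> x /=; rewrite !mulr1; have := fo.2 x point; rewrite ler_norml => /andP[].
  by move=> h1 h2; apply/andP; split; lra.
have := cP n f _ _ bf sf.
by have -> : f point + 1 - (f point - 1) = 2 by ring.
Qed.
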